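(* Let $(G_1,u_1,v_1)$ and $(G_2,u_2,v_2)$ be twice-marked graphs of genera $g_1,g_2$ on which all divisors are submodular, and let $(G,u,v)=(G,u_1,v_2)$ be their vertex gluing. Suppose the once-marked graph $(G_1,v_1)$ is Brill–Noether general and $(G_2,u_2,v_2)$ has $k$-general transmission with $k>g_1+g_2$. Then the once-marked graph $(G,v)$ is Brill–Noether general.
   Context: A graph is a finite, connected, loopless multigraph (parallel edges allowed); its genus is $g=|E(G)|-|V(G)|+1$. A divisor is an element of the free abelian group on $V(G)$. Linear equivalence $\sim$ is generated by chip-firing (firing $w$ subtracts $\mathrm{val}(w)$ chips from $w$ and adds to each other vertex the number of edges joining it to $w$). The rank $r(D)$ is $-1$ if $D$ is not equivalent to an effective divisor, else the largest $r\ge0$ such that $D-E$ is equivalent to an effective divisor for every effective $E$ of degree $r$. $\delta(P)$ is $1$ if $P$ holds and $0$ otherwise. A twice-marked graph $(G,u,v)$ is a graph with two chosen vertices. A twist of $D$ is $D+au+bv$. $\Delta(D)=r(D)-r(D-u)-r(D-v)+r(D-u-v)$. $D$ is submodular if $\Delta(D')\ge0$ for all twists $D'$. If $D$ is submodular, its transmission permutation $\tau^{u,v}_D$ is the unique bijection $\mathbb Z\to\mathbb Z$ with $\delta(\tau^{u,v}_D(b)=a)=\Delta(D+au-bv)$ for all $a,b$. An inversion of a bijection $\tau$ is a pair $(a,b)$ with $a<b$, $\tau(a)>\tau(b)$; two inversions $(a,b),(a',b')$ are $k$-equivalent if $a-a'=b-b'\equiv0\pmod k$; $\mathrm{inv}_k(\tau)$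 is the number of classes. A genus-$g$ twice-marked graph has $k$-general transmission if $ku\sim kv$, every divisor is submodular, and $\mathrm{inv}_k(\tau^{u,v}_D)\le g$ for every divisor $D$. Vertex gluing of $(G_1,u_1,v_1)$ and $(G_2,u_2,v_2)$ is $(G,u_1,v_2)$ where $G$ is the disjoint union with $v_1$ identified with $u_2$. For a vertex $v$ and divisor $D$ on a genus-$g$ graph, $s_i(D,v)=\min\{\ell\in\mathbb Z: r(D+\ell v)\ge i\}$ and $\lambda_i(D,v)=i-s_i(D,v)+g-\deg D$ for $i\ge0$; the Weierstrass partition $\lambda(D,v)=(\lambda_0,\lambda_1,\dots)$ is a nonincreasing sequence of nonnegative integers, finitely many nonzero, and $|\lambda(D,v)|=\sum_i\lambda_i(D,v)$. A once-marked graph $(G,v)$ of genus $g$ is Brill–Noether general if $|\lambda(D,v)|\le g$ for every divisor $D$. *)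

(* Defs.v *)
From HB Require Import structures.
From mathcomp Require Import all_boot all_order all_algebra.
From Stdlib Require Import ClassicalEpsilon.
Set Implicit Arguments. Unset Strict Implicit. Unset Printing Implicit Defensive.
Import Order.TTheory GRing.Theory Num.Theory.
Local Open Scope ring_scope.

Section ChipFiring.
Variable T : finType.
(* m x y = number of edges joining x and y *)
Variable m : T -> T -> nat.

Definition is_graph : Prop :=
  [/\ forall x y, m x y = m y x,
      forall x, m x x = 0%N &
      forall x y, connect (fun a b => (0 < m a b)%N) x y].

Definition genus : int :=
  ((\sum_(x : T) \sum_(y : T) m x y)%N %/ 2)%N%:Z - #|T|%:Z + 1.

Definition divisor := T -> int.

Definition deg (D : divisor) : int := \sum_(x : T) D x.
Definition effective (D : divisor) : Prop := forall x, 0 <= D x.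

Definition pt (u : T) : divisor := fun x => (x == u)%:Z.
Definition dadd (D E : divisor) : divisor := fun x => D x + E x.
Definition dscale (a : int) (D : divisor) : divisor := fun x => a * D x.
Definition dsub (D E : divisor) : divisor := fun x => D x - E x.

Definition valence (w : T) : int := \sum_(y : T) (m w y)%:Z.

Definition firing (w : T) : divisor :=
  fun x => if x == w then - valence w else (m w x)%:Z.

Definition lin_equiv (D D' : divisor) : Prop :=
  exists f : T -> int, forall x, D' x = D x + \sum_(w : T) f w * firing w x.

Definition equiv_eff (D : divisor) : Prop :=
  exists D', effective D' /\ lin_equiv D D'.

Definition rank_ge (D : divisor) (r : nat) : Prop :=
  forall E : divisor, effective E -> deg E = r%:Z -> equiv_eff (dsub D E).

Definition is_rank (D : divisor) (r : int) : Prop :=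
  (~ equiv_eff D /\ r = -1) \/
  (equiv_eff D /\ exists n : nat, r = n%:Z /\ rank_ge D n /\
     forall n' : nat, rank_ge D n' -> (n' <= n)%N).

Definition rank (D : divisor) : int := epsilon (inhabits 0) (is_rank D).

Definition Delta (u v : T) (D : divisor) : int :=
  rank D - rank (dsub D (pt u)) - rank (dsub D (pt v))
  + rank (dsub (dsub D (pt u)) (pt v)).

Definition twist (u v : T) (D : divisor) (a b : int) : divisor :=
  dadd (dadd D (dscale a (pt u))) (dscale b (pt v)).

Definition submodular (u v : T) (D : divisor) : Prop :=
  forall a b : int, 0 <= Delta u v (twist u v D a b).

Definition is_transmission (u v : T) (D : divisor) (tau : int -> int) : Prop :=
  bijective tau /\
  forall a b : int, Delta u v (twist u v D a (- b)) = (tau b == a)%:Z.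

Definition inversion (tau : int -> int) (p : int * int) : Prop :=
  p.1 < p.2 /\ tau p.2 < tau p.1.

Definition kequiv (k : int) (p q : int * int) : Prop :=
  p.1 - q.1 = p.2 - q.2 /\ (k %| p.1 - q.1)%Z.

(* inv_k(tau) <= g : the inversions of tau fall into at most g k-equivalence classes *)
Definition inv_k_le (k : int) (tau : int -> int) (g : int) : Prop :=
  exists s : seq (int * int), (size s)%:Z <= g /\
    forall p, inversion tau p -> exists2 q, q \in s & kequiv k p q.

Definition k_general_transmission (u v : T) (k : nat) : Prop :=
  [/\ lin_equiv (dscale k%:Z (pt u)) (dscale k%:Z (pt v)),
      forall D, submodular u v D &
      forall D, exists tau, is_transmission u v D tau /\ inv_k_le k%:Z tau genus].

Definition s_idx (D : divisor) (v : T) (i : nat) : int :=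
  epsilon (inhabits 0) (fun l : int =>
    i%:Z <= rank (dadd D (dscale l (pt v))) /\
    forall l' : int, i%:Z <= rank (dadd D (dscale l' (pt v))) -> l <= l').

Definition lambda (D : divisor) (v : T) (i : nat) : int :=
  i%:Z - s_idx D v i + genus - deg D.

(* |lambda(D,v)| <= g for every divisor D (lambda has finitely many nonzero terms) *)
Definition BN_general (v : T) : Prop :=
  forall D : divisor, exists N : nat,
    (forall j : nat, (N <= j)%N -> lambda D v j = 0) /\
    \sum_(i < N) lambda D v i <= genus.

End ChipFiring.

(* Vertex gluing: vertices of G1 plus vertices of G2 other than u2; u2 becomes v1. *)
Section Glue.
Variables (T1 T2 : finType) (v1 : T1) (u2 : T2).

Definition glueV : finType := (T1 + {y : T2 | y != u2})%type.

Definition glue1 (x : T1) : glueV := inl x.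
Definition glue2 (y : T2) : glueV :=
  match insub y with Some y' => inr y' | None => inl v1 end.

Definition glue_mult (m1 : T1 -> T1 -> nat) (m2 : T2 -> T2 -> nat)
  (p q : glueV) : nat :=
  (\sum_(x : T1) \sum_(y : T1) ((glue1 x == p) && (glue1 y == q)) * m1 x y
   + \sum_(x : T2) \sum_(y : T2) ((glue2 x == p) && (glue2 y == q)) * m2 x y)%N.
End Glue.
Arguments glue_mult {T1 T2} v1 u2 m1 m2 p q.
Arguments glue2 {T1 T2} v1 u2 y.

(* Main.v *)
Require Import Defs.
From mathcomp Require Import all_boot all_order all_algebra zify ring.
From Stdlib Require Import Classical ClassicalEpsilon FunctionalExtensionality.
Set Implicit Arguments. Unset Strict Implicit. Unset Printing Implicit Defensive.
Import Order.TTheory GRing.Theory Num.Theory.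
Local Open Scope ring_scope.

(** Write [f b = r(D - b v) + 1] on the glued graph, [alpha a = r(D1 - a v1) + 1] on [G1] and
    [rho b a = r(D2 + a u2 - b v2) + 1] on [G2].  Linear equivalence on a vertex gluing decouples
    up to moving chips through the common vertex, which yields the min-plus formula
    [f b = min_a (alpha a + rho b (a - 1))].  The size of the Weierstrass partition is the total
    excess of [f] over the nonspecial value [max 0 (chi - b)].  Since [k u2 ~ k v2], the transmission
    permutation [tau] of [D2] is an affine permutation; undoing one adjacent inversion at a time
    (a whole residue class mod [k]) changes [f] by one unit at isolated points.  Two such points
    would be at distance at least [k] and would force an excess of at least [k - 1] between them,
    which is impossible as [k > g1 + g2]; so each of the at most [g2] inversion classes adds at most
    one to the excess of [alpha], which is at most [g1].  The asymptotic form of Riemann-Roch needed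
    on [G2] follows from the acyclic-orientation divisor of degree [g - 1] on one side, and from the
    bound on the inversions of [tau] for the zero divisor on the other. *)

(** * Rank profiles and their excess *)

Lemma int_up_ind (P : int -> Prop) (b0 : int) :
  P b0 -> (forall b : int, b0 <= b -> P b -> P (b + 1)) -> forall b : int, b0 <= b -> P b.
Proof.
move=> P0 PS b leb; have -> : b = b0 + `|b - b0|%N%:Z by lia.
elim: `|b - b0|%N => [|n IH]; first by rewrite addr0.
have -> : b0 + n.+1%:Z = b0 + n%:Z + 1 by lia.
by apply: PS => //; lia.
Qed.

Lemma int_down_ind (P : int -> Prop) (b0 : int) :
  P b0 -> (forall b : int, b < b0 -> P (b + 1) -> P b) -> forall b : int, b <= b0 -> P b.
Proof.
move=> P0 PS b leb; have -> : b = b0 - `|b0 - b|%N%:Z by lia.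
elim: `|b0 - b|%N => [|n IH]; first by rewrite subr0.
apply: PS; first lia.
by have -> : b0 - n.+1%:Z + 1 = b0 - n%:Z by lia.
Qed.

Lemma int_min_exists (P : int -> Prop) (c : int) :
  (exists a : int, P a) -> (forall a : int, P a -> c <= a) ->
  exists a, P a /\ forall a', P a' -> a <= a'.
Proof.
move=> [a0 Pa0] lb; apply: NNPP => noMin.
suff H : forall b : int, c <= b -> forall a : int, P a -> b <= a.
  by have := H (a0 + 1) _ a0 Pa0; have := lb _ Pa0; lia.
apply: int_up_ind => // b _ IH a Pa.
case: (eqVneq a b) => [ab|]; last by have := IH _ Pa; lia.
by subst a; case: noMin; exists b.
Qed.

Lemma int_argmin_exists (F : int -> int) (c : int) :
  (forall a : int, c <= F a) -> exists a0 : int, forall a : int, F a0 <= F a.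
Proof.
move=> lb.
have [||m [[a ->] mmin]] := @int_min_exists (fun z => exists a, z = F a) c.
- by exists (F 0), 0.
- by move=> _ [a ->].
by exists a => a'; apply: mmin; exists a'.
Qed.

Definition unit_steps (f : int -> int) : Prop :=
  forall b : int, f (b + 1) <= f b <= f (b + 1) + 1.

(* For [f b = r(D - b v) + 1] the parameter [chi] is [deg D - g + 1], and [max 0 (chi - b)] is the
   value of [f b] when [D - b v] is nonspecial. *)
Definition excess (f : int -> int) (chi b : int) : int := f b - Order.max 0 (chi - b).

(** The end conditions describe a rank function far from zero: rank [-1] for large [b], and
    Riemann-Roch without a special term for very negative [b]. *)
Definition rank_profile (f : int -> int) (chi : int) : Prop :=
  [/\ unit_steps f, exists B : int, forall b : int, B <= b -> f b = 0 &
      exists L : int, forall b : int, b <= L -> f b = chi - b].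

(** Quantifying over finite duplicate-free lists bounds the total excess without naming its support;
    for a rank profile every term is nonnegative. *)
Definition excess_le (f : int -> int) (chi g : int) : Prop :=
  forall s : seq int, uniq s -> \sum_(b <- s) excess f chi b <= g.

Lemma unit_steps_le (f : int -> int) (b c : int) :
  unit_steps f -> b <= c -> f c <= f b /\ f b + b <= f c + c.
Proof.
move=> st; move: c; apply: int_up_ind => [|c _ [IH1 IH2]]; first by split.
by have := st c; lia.
Qed.

Lemma rank_profile_ge0 (f : int -> int) (chi b : int) : rank_profile f chi -> 0 <= f b.
Proof.
case=> st [B fB] _; have [|bB] := leP B b; first by move/fB ->.
by have [] := unit_steps_le st (ltW bB); rewrite (fB B).
Qed.

(** [f b + b] is nondecreasing and equals [chi] far to the left, so [f b >= chi - b] everywhere. *)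
Lemma excess_ge0 (f : int -> int) (chi b : int) :
  rank_profile f chi -> 0 <= excess f chi b.
Proof.
move=> pf; have := rank_profile_ge0 b pf; case: pf => st _ [L fL].
have [mb mL] : Order.min b L <= b /\ Order.min b L <= L by lia.
have := fL _ mL; have [_] := unit_steps_le st mb.
by rewrite /excess; lia.
Qed.

Lemma sum_le_support (e : int -> int) (s w : seq int) :
  (forall b, 0 <= e b) -> uniq s -> {in s, forall b : int, b \notin w -> e b = 0} ->
  \sum_(b <- s) e b <= \sum_(b <- w) e b.
Proof.
move=> e0; elim: s w => [|x s IH] w; first by rewrite big_nil sumr_ge0.
move=> /= /andP[xs us] ez; rewrite big_cons.
have [xw|xw] := boolP (x \in w).
  rewrite (big_rem x xw) /= lerD2l; apply: IH => // b bs bw.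
  apply: ez; first by rewrite inE bs orbT.
  apply: contra bw => bw; apply: rem_mem bw.
  by apply: contraNneq xs => <-.
rewrite (ez x) ?inE ?eqxx // add0r; apply: IH => // b bs.
by apply: ez; rewrite inE bs orbT.
Qed.

(* Counting the cells below the graph of [f] by rows and by columns. *)
Lemma sum_conjugate (f : int -> int) (t : nat -> int) (n N : nat) (L : int) :
  unit_steps f -> (forall (i : nat) (b : int), (i%:Z < f b) = (b <= t i)) ->
  f (L + n%:Z) = 0 -> f L = N%:Z ->
  \sum_(i < N) (t i - L) = \sum_(j < n) f (L + 1 + j%:Z).
Proof.
move=> st ft; elim: n N L => [|n IH] N L.
  by rewrite addr0 => -> [<-]; rewrite !big_ord0.
move=> fB fL.
have fB' : f (L + 1 + n%:Z) = 0 by rewrite -fB; congr f; lia.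
have {}IH := IH _ (L + 1) fB'.
have st' := st L.
rewrite big_ord_recl addr0.
have -> : \sum_(i < n) f (L + 1 + (lift ord0 i)%:Z)
        = \sum_(j < n) f (L + 1 + 1 + j%:Z).
  by apply: eq_bigr => j _; congr f; rewrite lift0; lia.
have f1ge : 0 <= f (L + 1).
  have [] // := @unit_steps_le f (L + 1) (L + 1 + n%:Z) st; first lia.
  by rewrite fB'.
have fM : f (L + 1) = (absz (f (L + 1)))%:Z by lia.
rewrite -(IH _ fM); set M := absz (f (L + 1)) in fM *.
have split_sum : \sum_(i < M) (t i - L) = M%:Z + \sum_(i < M) (t i - (L + 1)).
  rewrite -natz -[M in M%:R]card_ord -sumr_const -big_split /=.
  by apply: eq_bigr => i _; lia.
have [NM|NM] : N = M \/ N = M.+1 by lia.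
  by rewrite NM split_sum fM.
rewrite NM big_ord_recr /= split_sum fM.
(* Row [M] ends exactly at [L], so it has no cell to the right of [L]. *)
have tM : t M = L; last by rewrite tM subrr addr0.
by have := ft M L; have := ft M (L + 1); lia.
Qed.

(** The cells of [f] and of the nonspecial function [max 0 (chi - b)] are counted by rows and by
    columns on a common window, and the counts are subtracted. With [t i = - s_i] the left-hand
    summands are the parts of the Weierstrass partition. *)
Lemma excess_sum_conjugate (f : int -> int) (chi : int) (t : nat -> int) :
  rank_profile f chi -> (forall (i : nat) (b : int), (i%:Z < f b) = (b <= t i)) ->
  exists (N : nat) (w : seq int),
    [/\ forall j : nat, (N <= j)%N -> t j = chi - 1 - j%:Z,
        uniq w, forall b : int, b \notin w -> excess f chi b = 0 &
        \sum_(i < N) (t i - (chi - 1 - i%:Z)) = \sum_(b <- w) excess f chi b].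
Proof.
move=> [st [B fB] [L0 fL]] ft.
(* Up to [L] both functions equal [chi - b]; from [H] on both vanish. *)
pose L : int := Order.min L0 chi; pose H : int := Order.max B chi.
have [LL0 Lchi] : L <= L0 /\ L <= chi by lia.
have [HB Hchi] : B <= H /\ chi <= H by lia.
have [n Hn] : exists n : nat, H = L + n%:Z by exists (absz (H - L)%R); lia.
have [N HN] : exists N : nat, chi - L = N%:Z by exists (absz (chi - L)%R); lia.
clearbody L H.
exists N, [seq L + 1 + j%:Z | j <- iota 0 n]; split.
- move=> j Nj; have := ft j (chi - 1 - j%:Z); have := ft j (chi - j%:Z).
  by rewrite !fL; lia.
- by rewrite map_inj_uniq ?iota_uniq // => i j; lia.
- move=> b /negP bw; rewrite /excess.
  have [bL|bL] := leP b L; first by rewrite fL; lia.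
  have [bH|bH] := leP H b; first by rewrite fB; lia.
  case: bw; apply/mapP; exists (absz (b - L - 1)%R); first by rewrite mem_iota; lia.
  by lia.
have -> : \sum_(i < N) (t i - (chi - 1 - i%:Z))
        = \sum_(i < N) (t i - L) - \sum_(i < N) ((chi - 1 - i%:Z) - L).
  by rewrite -sumrB; apply: eq_bigr => i _; lia.
rewrite (@sum_conjugate f t n N L) //; first last.
- by rewrite fL //; lia.
- by rewrite -Hn fB.
rewrite (@sum_conjugate (fun b : int => Order.max 0 (chi - b)) (fun i => chi - 1 - i%:Z) n N L).
- by rewrite -sumrB big_map -[n in iota 0 n]subn0 big_mkord.
- by move=> b; lia.
- by move=> i b; lia.
- by lia.
- by lia.
Qed.

(** * Min-plus formula and transmission in integrated form *)

(** The shift to [a - 1] reflects that a number of chips crossing the common vertex is either at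
    least [a] or at most [a - 1]. *)
Definition is_min_plus (alpha : int -> int) (rho : int -> int -> int) (f : int -> int) :=
  forall b : int, (forall a : int, f b <= alpha a + rho b (a - 1)) /\
                  exists a : int, f b = alpha a + rho b (a - 1).

(** This is the condition on [Delta] summed over [a]. It makes [rho b a] the number of [b' >= b]
    with [tau b' <= a]. *)
Definition transmits (tau : int -> int) (rho : int -> int -> int) :=
  (forall b a : int, rho b a = rho (b + 1) a + (tau b <= a)%R%:Z) /\
  (forall a : int, exists B : int, forall b : int, B <= b -> rho b a = 0).

Lemma transmits_ge0 tau rho b a : transmits tau rho -> 0 <= rho b a.
Proof.
move=> [rec van]; have [B rB] := van a.
have [Bb|Bb] := leP B b; first by rewrite rB.
move: b {Bb}(ltW Bb); apply: int_down_ind => [|b _ IH]; first by rewrite rB.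
by rewrite rec; lia.
Qed.

(** The functions [rho] met while undoing inversions are not given by divisors, so their min-plus
    product has to be constructed. *)
Lemma min_plus_exists (alpha : int -> int) (rho : int -> int -> int) :
  (forall a : int, 0 <= alpha a) -> (forall b a : int, 0 <= rho b a) ->
  exists f, is_min_plus alpha rho f.
Proof.
move=> a0 r0.
have ex b : exists a0, forall a, alpha a0 + rho b (a0 - 1) <= alpha a + rho b (a - 1).
  by apply: (@int_argmin_exists _ 0) => a; apply: addr_ge0.
pose m b := epsilon (inhabits 0)
  (fun a0 => forall a, alpha a0 + rho b (a0 - 1) <= alpha a + rho b (a - 1)).
exists (fun b => alpha (m b) + rho b (m b - 1)) => b; split; last by exists (m b).
exact: (epsilon_spec (inhabits (0 : int)) _ (ex b)).
Qed.

Lemma min_plus_le alpha rho rho' f f' (b : int) :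
  is_min_plus alpha rho f -> is_min_plus alpha rho' f' ->
  (forall a : int, rho b a <= rho' b a) -> f b <= f' b.
Proof.
move=> /(_ b) [mf _] /(_ b) [_ [a ->]] le.
by have := mf a; have := le (a - 1); lia.
Qed.

Lemma min_plus_steps alpha tau rho f :
  transmits tau rho -> is_min_plus alpha rho f -> unit_steps f.
Proof.
move=> [rec _] mf b; have [m1 [a1 e1]] := mf b; have [m2 [a2 e2]] := mf (b + 1).
have := m1 a2; have := m2 a1; have := rec b (a1 - 1); have := rec b (a2 - 1).
by rewrite e1 e2; lia.
Qed.

(** * Affine permutations acting on rank profiles *)

(** By injectivity each step is strictly increasing, and by surjectivity the value [tau n + 1]
    cannot be skipped. *)
Lemma bijection_mono_shift (tau : int -> int) :
  bijective tau -> (forall n : int, tau n <= tau (n + 1)) ->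
  exists c : int, forall b : int, tau b = b + c.
Proof.
move=> [tinv tK Kt] mono.
have inc (b c : int) : b <= c -> tau b <= tau c.
  by move: c; apply: int_up_ind => [|c _ /le_trans] //; apply.
have nxt (n : int) : tau (n + 1) = tau n + 1.
  have [mn|nm] := leP (tinv (tau n + 1)) n.
    by have := inc _ _ mn; rewrite Kt; lia.
  have := @inc (n + 1) (tinv (tau n + 1)); rewrite Kt.
  have : tau (n + 1) <> tau n by move/(can_inj tK); lia.
  by have := mono n; lia.
exists (tau 0) => b; have [b0|b0] := leP 0 b.
  by move: b b0; apply: int_up_ind => [|b _ IH]; [rewrite add0r | rewrite nxt; lia].
by move: b {b0}(ltW b0); apply: int_down_ind => [|b _]; [rewrite add0r | rewrite nxt; lia].
Qed.

Lemma transmits_shift tau rho (c b a : int) :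
  transmits tau rho -> (forall b : int, tau b = b + c) ->
  rho b a = Order.max 0 (a + 1 - b - c).
Proof.
move=> [rec van] tE; have [B rB] := van a.
pose B' : int := Order.max B (a + 1 - c).
have rB' (x : int) : B' <= x -> rho x a = Order.max 0 (a + 1 - x - c).
  by move=> lex; rewrite rB; lia.
have [|Bb] := leP B' b; first exact: rB'.
move: b {Bb}(ltW Bb); apply: int_down_ind => [|b _ IH]; first exact: rB'.
by rewrite rec IH tE; lia.
Qed.

(** Here [f b] is the minimum of [alpha a + max 0 (a - b - c)]. Unit steps of [alpha] place it at
    [a = b + c], so [f] is a translate of [alpha]. *)
Lemma excess_le_shift alpha tau rho f (chi1 chi c g : int) :
  transmits tau rho -> (forall b : int, tau b = b + c) -> is_min_plus alpha rho f ->
  rank_profile alpha chi1 -> rank_profile f chi ->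
  excess_le alpha chi1 g -> excess_le f chi g.
Proof.
move=> tr tE mf pa pf ea.
have fE (b : int) : f b = alpha (b + c).
  have [lo [a fa]] := mf b; have := lo (b + c).
  rewrite (transmits_shift _ _ tr tE) fa (transmits_shift _ _ tr tE).
  case: (pa) => st _ _.
  have [ba|ba] := leP (b + c) a; first by have := unit_steps_le st ba; lia.
  by have := unit_steps_le st (ltW ba); lia.
(* The parameters are compared far to the left, where both profiles are linear. *)
have chiE : chi = chi1 - c.
  case: pa pf => _ _ [La aL] [_ _ [Lf fL]].
  pose b : int := Order.min (La - c) Lf.
  have := fE b; rewrite fL; last by lia.
  by rewrite aL; lia.
move=> s us.
have -> : \sum_(b <- s) excess f chi b = \sum_(b <- map (fun b => b + c) s) excess alpha chi1 b.
  by rewrite big_map; apply: eq_bigr => b _; rewrite /excess fE chiE; lia.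
by apply: ea; rewrite map_inj_uniq // => x y; lia.
Qed.

(** The flat step at [b1] raises [f x + x] to at least [chi + 1] for all later [x], and [f] stays
    positive up to [b2 - 1]. Each of the [b2 - b1 - 1] points strictly between therefore has excess
    at least one. *)
Lemma excess_sum_between (f : int -> int) (chi b1 b2 g : int) :
  rank_profile f chi -> excess_le f chi g -> b1 < b2 ->
  f b1 <= f (b1 + 1) -> 0 < f (b2 - 1) -> b2 - b1 - 1 <= g.
Proof.
move=> pf ef lt12 h1 h2.
pose s := [seq b1 + 1 + j%:Z | j <- iota 0 (absz (b2 - b1 - 1)%R)].
have us : uniq s by rewrite map_inj_uniq ?iota_uniq // => i j; lia.
apply: le_trans (ef _ us).
have -> : b2 - b1 - 1 = \sum_(b <- s) 1.
  by rewrite big_const_seq count_predT size_map size_iota iter_addr_0 natz; lia.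
rewrite big_seq [leRHS]big_seq; apply: ler_sum => b /mapP[j].
rewrite mem_iota => jn ->; set x := b1 + 1 + j%:Z.
have := excess_ge0 b1 pf; case: pf => st _ _.
have [|_ le1] := @unit_steps_le f (b1 + 1) x st; first lia.
have [|le2 _] := @unit_steps_le f x (b2 - 1) st; first lia.
by rewrite /excess; lia.
Qed.

(** * Swapping adjacent positions along a residue class *)

Section AdjacentSwap.
Variables (k n : int).
Hypothesis k_gt1 : 1 < k.

(** A simple reflection of the affine symmetric group: the product of the transpositions of
    [n + j k] and [n + 1 + j k] over all [j], which are disjoint because [k > 1]. *)
Definition swap (b : int) : int :=
  if (k %| b - n)%Z then b + 1 else if (k %| b - n - 1)%Z then b - 1 else b.

Lemma dvd_gap (x y : int) : (k %| x)%Z -> (k %| y)%Z -> x < y -> x + k <= y.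
Proof.
move=> kx ky; have : (k %| y - x)%Z by rewrite rpredB.
case/dvdzP=> q xyE lt {kx ky}.
have q0 : 0 < q by rewrite -(pmulr_lgt0 _ (lt_trans ltr01 k_gt1)) -xyE; lia.
by nia.
Qed.

Lemma swapK : involutive swap.
Proof.
move=> b; rewrite {2}/swap.
case: ifP => h1.
  rewrite /swap; case: ifP => h2; first by move: (dvd_gap h1 h2) => {h1 h2}; lia.
  have -> : b + 1 - n - 1 = b - n by lia.
  by rewrite h1; lia.
case: ifP => h2; last by rewrite /swap h1 h2.
rewrite /swap; have -> : b - 1 - n = b - n - 1 by lia.
by rewrite h2; lia.
Qed.

Lemma swapl (b : int) : (k %| b - n)%Z -> swap b = b + 1.
Proof. by rewrite /swap => ->. Qed.

Lemma swapr (b : int) : (k %| b - n)%Z -> swap (b + 1) = b.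
Proof. by move=> kb; rewrite -[in LHS](swapl kb) swapK. Qed.

Lemma swap_shift (b j : int) : (k %| j)%Z -> swap (b + j) = swap b + j.
Proof.
move=> kj; rewrite /swap.
have -> : b + j - n - 1 = (b - n - 1) + j by lia.
have -> : b + j - n = (b - n) + j by lia.
by rewrite !(rpredDr _ kj); case: ifP => _; [|case: ifP => _]; lia.
Qed.

Lemma swap_lt (p q : int) : p < q -> ~ ((k %| p - n)%Z /\ q = p + 1) -> swap p < swap q.
Proof.
move=> pq npq; rewrite /swap.
case: (boolP (k %| p - n)%Z) => hp.
  have qp : q <> p + 1 by move=> qE; case: npq.
  case: ifP => _; first by lia.
  by case: ifP => [hq|_]; first move: (dvd_gap hp hq) => {hp hq npq}; lia.
case: ifP => _; case: ifP => _; try lia; case: ifP => hq; try lia.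
have qp : q <> p + 1; last by lia.
by move=> qE; move: hq; have -> : q - n - 1 = p - n by [lia]; rewrite (negPf hp).
Qed.

(** The swap sends inversions of [tau \o swap] to inversions of [tau] outside the class of
    [(n, n + 1)]. Dropping the representatives of that class, of which there is at least one, and
    swapping the others gives a shorter cover. *)
Lemma swap_inversions (tau : int -> int) (s : seq (int * int)) :
  (forall p, inversion tau p -> exists2 q, q \in s & kequiv k p q) ->
  (forall b j : int, (k %| j)%Z -> tau (b + j) = tau b + j) ->
  tau (n + 1) < tau n ->
  exists s' : seq (int * int), (size s' < size s)%N /\
    forall p, inversion (tau \o swap) p -> exists2 q, q \in s' & kequiv k p q.
Proof.
move=> cov per inv_n.
pose bad (q : int * int) := (k %| q.1 - n)%Z && (q.2 == q.1 + 1).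
pose sw (q : int * int) := (swap q.1, swap q.2).
exists [seq sw q | q <- s & ~~ bad q]; split.
  rewrite size_map size_filter -(count_predC bad s) -[ltnLHS]add0n ltn_add2r.
  have [|q qs [/= e1 e2]] := cov (n, n + 1); first by split=> //=; lia.
  rewrite -has_count; apply/hasP; exists q => //; rewrite /bad.
  by rewrite -opprB rpredN e2; lia.
move=> [p q] [/= pq tpq].
have nbad : ~ ((k %| p - n)%Z /\ q = p + 1).
  move=> [kp qE]; move: tpq; rewrite qE (swapl kp) (swapr kp).
  have := per n _ kp; have := per (n + 1) _ kp.
  have -> : n + (p - n) = p by lia.
  have -> : n + 1 + (p - n) = p + 1 by lia.
  by lia.
have [|[q1 q2] qs [/= e1 e2]] := cov (swap p, swap q).
  by split=> //=; apply: swap_lt.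
exists (sw (q1, q2)).
  apply: map_f; rewrite mem_filter qs andbT /bad /=.
  (* A dropped representative would give [swap p = q] and [p = q + 1], against [p < q]. *)
  apply/negP => /andP[kq /eqP q2E]; subst q2.
  have qpE : swap q = swap p + 1 by lia.
  have kp : (k %| swap p - n)%Z.
    have -> : swap p - n = (swap p - q1) + (q1 - n) by lia.
    by rewrite rpredD.
  have := congr1 swap qpE; rewrite swapK (swapr kp) => qE.
  by have := swapK p; rewrite (swapl kp); lia.
have e2k : (k %| swap q - q2)%Z by rewrite -e1.
have pE : p = swap q1 + (swap p - q1).
  by rewrite -swap_shift // addrC subrK swapK.
have qE : q = swap q2 + (swap q - q2).
  by rewrite -swap_shift // addrC subrK swapK.
rewrite /sw; split=> /=; first by rewrite [in LHS]pE [in RHS]qE; lia.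
by rewrite [in X in (_ %| X)%Z]pE addrC addKr.
Qed.
End AdjacentSwap.

(** The half-line of positions [>= b] is stable under the swap unless [b] is the right end of a
    swapped pair; then its image is the half-line from [b + 1] together with [b - 1]. *)
Lemma transmits_swap (k n : int) (tau : int -> int) (rho : int -> int -> int) :
  1 < k -> transmits tau rho ->
  transmits (tau \o swap k n)
    (fun b a : int => if (k %| b - n - 1)%Z then rho (b + 1) a + (tau (b - 1) <= a)%R%:Z
                else rho b a).
Proof.
move=> k1 [rec van]; split=> [b a|a]; last first.
  have [B rB] := van a; exists (B + 1) => b Bb.
  have := rec (b - 1) a; rewrite subrK; case: ifP => _; rewrite !rB; lia.
rewrite /swap /=.
have -> : b + 1 - n - 1 = b - n by lia.
have [hb|hb] := boolP (k %| b - n)%Z.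
  case: ifP => hb1; first by move: (dvd_gap k1 hb1 hb) => {hb hb1}; lia.
  by rewrite rec (rec (b + 1)) addrK; lia.
case: ifP => // _; exact: rec.
Qed.

(** The swap lowers [f] at no more than one point, and there by one. The profile of [f'] is
    established inside the proof, which is why the bound on its excess is assumed conditionally. *)
Lemma min_plus_swap_excess (k n : int) (alpha tau f f' : int -> int)
  (rho rho' : int -> int -> int) (chi g : int) :
  1 < k -> (forall a : int, 0 <= alpha a) -> transmits tau rho ->
  (forall b j : int, (k %| j)%Z -> tau (b + j) = tau b + j) ->
  tau (n + 1) < tau n ->
  rho' = (fun b a : int => if (k %| b - n - 1)%Z then rho (b + 1) a + (tau (b - 1) <= a)%R%:Z
                else rho b a) ->
  is_min_plus alpha rho f -> is_min_plus alpha rho' f' ->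
  rank_profile f chi -> g < k - 1 ->
  (rank_profile f' chi -> excess_le f' chi g) -> excess_le f chi (g + 1).
Proof.
move=> k1 a0 tr per inv_n rhoE mf mf' pf gk ef'.
have tr' := transmits_swap n k1 tr; rewrite -rhoE in tr'.
have st := min_plus_steps tr mf; have st' := min_plus_steps tr' mf'.
have same (b : int) : ~~ (k %| b - n - 1)%Z -> f' b = f b.
  move=> hb; apply/eqP; rewrite eq_le (min_plus_le mf' mf) ?(min_plus_le mf mf') // => a;
  by rewrite rhoE (negPf hb).
have nbr (b : int) : (k %| b - n - 1)%Z -> f' (b + 1) = f (b + 1) /\ f' (b - 1) = f (b - 1).
  move=> hb; split; apply: same; apply/negP => h.
    by move: (dvd_gap k1 hb h) => {hb h}; lia.
  by move: (dvd_gap k1 h hb) => {hb h}; lia.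
have le_f (b : int) : f' b <= f b.
  have [hb|hb] := boolP (k %| b - n - 1)%Z; last by rewrite same.
  (* By periodicity [tau b < tau (b - 1)], so replacing the condition [tau b <= a] by
     [tau (b - 1) <= a] can only decrease the count. *)
  apply: (min_plus_le mf' mf) => a; case: tr => rec _; rewrite rhoE hb (rec b a).
  have := per n _ hb; have := per (n + 1) _ hb.
  have -> : n + (b - n - 1) = b - 1 by lia.
  have -> : n + 1 + (b - n - 1) = b by lia.
  by lia.
have pf' : rank_profile f' chi.
  case: pf => _ [B fB] [L fL]; split=> //.
    exists B => b Bb; have := le_f b; rewrite fB // => le0.
    have : 0 <= f' b; last by lia.
    have [_ [a ->]] := mf' b.
    by rewrite addr_ge0 // (transmits_ge0 _ _ tr').
  (* One unit of margin keeps [b + 1] in the linear range of [f]; both neighbours then determine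
     [f' b] through the unit steps. *)
  exists (L - 1) => b bL.
  have [hb|hb] := boolP (k %| b - n - 1)%Z; last by rewrite same ?fL //; lia.
  have [e1 e2] := nbr b hb; have := st' b; have := st' (b - 1).
  by rewrite subrK e1 e2 !fL; lia.
have {}ef' := ef' pf'.
(* Both functions agree at [b - 1] and [b + 1] and have unit steps, so a difference at [b] fixes the
   local shape: [f'] drops before [b] and is flat after it. *)
have jump (b : int) : f b <> f' b ->
    [/\ (k %| b - n - 1)%Z, f b = f' b + 1, f' (b - 1) = f' b + 1 & f' b = f' (b + 1)].
  move=> ne; have [hb|hb] := boolP (k %| b - n - 1)%Z; last by rewrite same in ne.
  have [e1 e2] := nbr b hb; have := st' b; have := st' (b - 1).
  have := st b; have := st (b - 1); have := le_f b.
  by rewrite subrK -e1 -e2; split=> //; lia.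
(* Two jumps would force [f'] to have excess at least [1] strictly between them. *)
have uniq_jump (b1 b2 : int) : b1 < b2 -> f b1 <> f' b1 -> f b2 <> f' b2 -> False.
  move=> lt12 /jump[k1' _ _ h1] /jump[k2' _ h2 _].
  have := @excess_sum_between f' chi b1 b2 g pf' ef' lt12.
  have := rank_profile_ge0 b2 pf'.
  have := dvd_gap k1 k1' k2'.
  by move=> {k1' k2'}; lia.
move=> s us.
have [[x [xs xj]]|nox] := classic (exists x, x \in s /\ f x <> f' x).
  have [_ xE _ _] := jump _ xj.
  rewrite (big_rem x xs) /=.
  have -> : \sum_(y <- rem x s) excess f chi y = \sum_(y <- rem x s) excess f' chi y.
    rewrite big_seq [RHS]big_seq; apply: eq_bigr => y.
    rewrite mem_rem_uniq // inE => /andP[/eqP yx _]; rewrite /excess.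
    have -> // : f y = f' y.
    apply: NNPP => yj.
    by have [] := ltrgtP x y => // lt; [apply: uniq_jump lt _ _|apply: uniq_jump lt _ _|case: yx].
  have -> : excess f chi x = excess f' chi x + 1 by rewrite /excess xE; lia.
  by rewrite addrAC lerD2r; have := ef' _ us; rewrite (big_rem x xs).
have -> : \sum_(y <- s) excess f chi y = \sum_(y <- s) excess f' chi y.
  rewrite big_seq [RHS]big_seq; apply: eq_bigr => y ys; rewrite /excess.
  by have -> // : f y = f' y by apply: NNPP => yj; case: nox; exists y.
by have := ef' _ us; lia.
Qed.

(** Induction on the size of the cover [s]. Without a descent [tau] is a translation and the excess
    is that of [alpha]; at a descent one swap shortens the cover and costs at most one unit. *)
Lemma min_plus_excess (k g : int) (alpha tau f : int -> int) (rho : int -> int -> int)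
    (chi1 chi : int) (s : seq (int * int)) :
  0 < k -> rank_profile alpha chi1 -> excess_le alpha chi1 g ->
  bijective tau -> (forall b j : int, (k %| j)%Z -> tau (b + j) = tau b + j) ->
  (forall p, inversion tau p -> exists2 q, q \in s & kequiv k p q) ->
  transmits tau rho -> is_min_plus alpha rho f -> rank_profile f chi ->
  g + (size s)%:Z < k -> excess_le f chi (g + (size s)%:Z).
Proof.
move=> k0 pa ea; have [m] := ubnP (size s).
elim: m s tau rho f => // m IH s tau rho f sm bt per cov tr mf pf gk.
have [[n inv_n]|noinv] := classic (exists n : int, tau (n + 1) < tau n); last first.
  have [n|c tE] := bijection_mono_shift bt.
    by have [//|lt] := leP (tau n) (tau (n + 1)); case: noinv; exists n.
  move=> w uw; have := excess_le_shift tr tE mf pa pf ea uw.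
  by move/le_trans; apply; lia.
(* For [k = 1] periodicity gives [tau (n + 1) = tau n + 1], which excludes a descent. *)
have k1 : 1 < k.
  have : k <> 1 by move=> k1; have := per n 1; rewrite k1 dvd1z => /(_ isT); lia.
  by lia.
have a0 a := rank_profile_ge0 a pa.
have [s' [ss' cov']] := swap_inversions k1 cov per inv_n.
have tr' := transmits_swap n k1 tr.
set rho' := (fun b a : int => _) in tr'.
have [f' mf'] := min_plus_exists a0 (fun b a => transmits_ge0 b a tr').
have H := min_plus_swap_excess k1 a0 tr per inv_n (erefl rho') mf mf' pf.
move=> w uw; suff E : excess_le f chi (g + (size s')%:Z + 1).
  by apply: le_trans (E _ uw) _; lia.
apply: H => [|pf']; first by lia.
apply: (IH _ (tau \o swap k n) rho') => //.
- by apply: leq_trans ss' _; lia.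
- apply: bij_comp bt _; exists (swap k n); exact: swapK.
- by move=> b j kj /=; rewrite swap_shift // per.
- by lia.
Qed.

(** * Chip firing *)

Ltac divisor_ring :=
  apply: functional_extensionality => ?; rewrite /twist /dadd /dsub /dscale; ring.

Section ChipFiringTheory.
Variables (T : finType) (m : T -> T -> nat).
Hypotheses (m_sym : forall x y, m x y = m y x) (m_loopless : forall x, m x x = 0%N).
Implicit Types (D E : divisor T) (u v w x : T).

(** The net effect of firing each [y] exactly [f y] times, written in differences so that adding a
    constant to [f] visibly changes nothing. *)
Definition laplacian (f : T -> int) : divisor T :=
  fun x => \sum_y (m x y)%:Z * (f y - f x).

Lemma sum_firing (f : T -> int) x : \sum_w f w * firing m w x = laplacian f x.
Proof.
rewrite /laplacian (bigD1 x) //= [RHS](bigD1 x) //= subrr mulr0 add0r /firing eqxx.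
rewrite /valence (bigD1 x) //= m_loopless add0r mulrN mulr_sumr -sumrN -big_split /=.
apply: eq_bigr => w /negPf wx; rewrite eq_sym wx (m_sym w x); ring.
Qed.

Lemma lin_equivE D D' :
  lin_equiv m D D' <-> exists f, forall x, D' x = D x + laplacian f x.
Proof.
by split=> -[f fE]; exists f => x; rewrite fE sum_firing.
Qed.

Lemma deg_laplacian (f : T -> int) : deg (laplacian f) = 0.
Proof.
rewrite /deg /laplacian.
under eq_bigr => x _ do (under eq_bigr => y _ do rewrite mulrBr; rewrite sumrB).
rewrite sumrB exchange_big /= -sumrB big1 // => x _.
by rewrite -sumrB big1 // => y _; rewrite (m_sym x y) subrr.
Qed.

Lemma laplacianD (f g : T -> int) x :
  laplacian (fun y => f y + g y) x = laplacian f x + laplacian g x.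
Proof. by rewrite -big_split; apply: eq_bigr => y _ /=; ring. Qed.

Lemma laplacianN (f : T -> int) x : laplacian (fun y => - f y) x = - laplacian f x.
Proof. by rewrite /laplacian -sumrN; apply: eq_bigr => y _ /=; ring. Qed.

Lemma laplacian_cst (f : T -> int) (c : int) x :
  laplacian (fun y => f y - c) x = laplacian f x.
Proof. by apply: eq_bigr => y _ /=; ring. Qed.

Lemma degD D E : deg (dadd D E) = deg D + deg E.
Proof. exact: big_split. Qed.

Lemma degB D E : deg (dsub D E) = deg D - deg E.
Proof. exact: sumrB. Qed.

Lemma degZ (a : int) D : deg (dscale a D) = a * deg D.
Proof. by rewrite /deg mulr_sumr. Qed.

Lemma deg_pt u : deg (pt u) = 1.
Proof. by rewrite /deg (bigD1 u) //= big1 /pt ?eqxx // => x /negPf ->. Qed.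

Lemma lin_equiv_refl D : lin_equiv m D D.
Proof.
apply/lin_equivE; exists (fun=> 0) => x.
by rewrite /laplacian big1 ?addr0 // => y _ /=; rewrite mulr0.
Qed.

Lemma lin_equiv_sym D D' : lin_equiv m D D' -> lin_equiv m D' D.
Proof.
case/lin_equivE=> f fE; apply/lin_equivE; exists (fun x => - f x) => x.
by rewrite fE laplacianN addrK.
Qed.

Lemma lin_equivD D D' E E' :
  lin_equiv m D D' -> lin_equiv m E E' -> lin_equiv m (dadd D E) (dadd D' E').
Proof.
case/lin_equivE=> f fE /lin_equivE[g gE]; apply/lin_equivE.
by exists (fun x => f x + g x) => x; rewrite /dadd fE gE laplacianD; ring.
Qed.

Lemma lin_equiv_trans D1 D2 D3 :
  lin_equiv m D1 D2 -> lin_equiv m D2 D3 -> lin_equiv m D1 D3.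
Proof.
case/lin_equivE=> f fE /lin_equivE[g gE]; apply/lin_equivE.
by exists (fun x => f x + g x) => x; rewrite gE fE laplacianD; ring.
Qed.

Lemma deg_lin_equiv D D' : lin_equiv m D D' -> deg D' = deg D.
Proof.
case/lin_equivE=> f fE; rewrite /deg (eq_bigr _ (fun x _ => fE x)) big_split /=.
by rewrite -/(deg (laplacian f)) deg_laplacian addr0.
Qed.

Lemma effectiveD D E : effective D -> effective E -> effective (dadd D E).
Proof. by move=> D0 E0 x; apply: addr_ge0. Qed.

Lemma effective_pt u : effective (pt u).
Proof. by []. Qed.

Lemma effectiveZ (n : nat) D : effective D -> effective (dscale n%:Z D).
Proof. by move=> D0 x; apply: mulr_ge0. Qed.

Lemma deg_effective D : effective D -> 0 <= deg D.
Proof. by move=> D0; apply: sumr_ge0. Qed.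

Lemma effective_equiv_eff D : effective D -> equiv_eff m D.
Proof. by move=> D0; exists D; split=> //; apply: lin_equiv_refl. Qed.

Lemma equiv_eff_lin_equiv D D' : lin_equiv m D D' -> equiv_eff m D' -> equiv_eff m D.
Proof. by move=> DD' [E [E0 D'E]]; exists E; split=> //; apply: lin_equiv_trans D'E. Qed.

Lemma equiv_effD D E : equiv_eff m D -> equiv_eff m E -> equiv_eff m (dadd D E).
Proof.
move=> [D' [D0 DD']] [E' [E0 EE']]; exists (dadd D' E').
by split; [apply: effectiveD | apply: lin_equivD].
Qed.

Lemma equiv_eff_deg D : equiv_eff m D -> 0 <= deg D.
Proof. by case=> D' [D0 /deg_lin_equiv <-]; apply: deg_effective. Qed.

Lemma rank_ge_lin_equiv D D' n : lin_equiv m D D' -> rank_ge m D' n -> rank_ge m D n.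
Proof.
move=> DD' rD' E E0 dE; apply: equiv_eff_lin_equiv (rD' E E0 dE).
have eqE F : dsub F E = dadd F (dscale (-1) E) by divisor_ring.
by rewrite !eqE; apply: lin_equivD DD' (lin_equiv_refl _).
Qed.

Lemma rank_ge_sub D E (n e : nat) :
  effective E -> deg E = e%:Z -> rank_ge m D (n + e) -> rank_ge m (dsub D E) n.
Proof.
move=> E0 dE rD F F0 dF.
have -> : dsub (dsub D E) F = dsub D (dadd F E) by divisor_ring.
by apply: rD; [apply: effectiveD | rewrite degD dF dE].
Qed.

Lemma rank_geD D E n : effective E -> rank_ge m D n -> rank_ge m (dadd D E) n.
Proof.
move=> E0 rD F F0 dF.
have -> : dsub (dadd D E) F = dadd (dsub D F) E by divisor_ring.
by apply: equiv_effD (rD _ F0 dF) _; apply: effective_equiv_eff.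
Qed.

Lemma rank_ge_leq (x0 : T) D (n n' : nat) :
  (n' <= n)%N -> rank_ge m D n -> rank_ge m D n'.
Proof.
move=> le rD; pose E := dscale (n - n')%N%:Z (pt x0).
have E0 : effective E by apply: effectiveZ; apply: effective_pt.
have -> : D = dadd (dsub D E) E by divisor_ring.
apply: rank_geD => //; apply: (@rank_ge_sub _ _ _ (n - n')%N) => //.
  by rewrite degZ deg_pt mulr1.
by rewrite subnKC.
Qed.

Lemma rank_ge0 D : rank_ge m D 0 <-> equiv_eff m D.
Proof.
split=> [/(_ (dscale 0 D))|[D' [D0 DD']]].
  have -> : dsub D (dscale 0 D) = D by divisor_ring.
  by apply=> [x|]; rewrite ?degZ /dscale mul0r.
move=> E E0 dE; have EE x : E x = 0.
  apply/eqP; have /eqP := dE.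
  by rewrite /deg psumr_eq0 // => /allP/(_ x); apply; rewrite mem_index_enum.
have -> : dsub D E = D by apply: functional_extensionality => x; rewrite /dsub EE subr0.
by exists D'.
Qed.

(** Testing against [n] chips at [x0] suffices. The vertex [x0] excludes the empty vertex set, where
    [rank_ge] is vacuous for [n > 0]. *)
Lemma rank_ge_deg (x0 : T) D (n : nat) : rank_ge m D n -> n%:Z <= deg D.
Proof.
move=> rn; have := rn (dscale n%:Z (pt x0)); rewrite degZ deg_pt mulr1.
move=> /(_ (effectiveZ n (effective_pt x0)) erefl)/equiv_eff_deg.
by rewrite degB degZ deg_pt mulr1 subr_ge0.
Qed.

Lemma is_rank_rank (x0 : T) D : is_rank m D (rank m D).
Proof.
apply: epsilon_spec; have [eff|neff] := classic (equiv_eff m D); last first.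
  by exists (-1); left.
(* The largest [n] is found as the least [- n], bounded by the degree. *)
pose P (a : int) := exists2 n : nat, a = - n%:Z & rank_ge m D n.
have [||a [[n aE rn] amin]] := @int_min_exists P (- deg D).
- by exists 0, 0%N => //; apply/rank_ge0.
- by move=> _ [n -> /(rank_ge_deg x0)]; rewrite lerN2.
exists n%:Z; right; split=> //; exists n; split=> //; split=> // n' rn'.
by have := amin (- n'%:Z); rewrite aE lerN2 lez_nat; apply; exists n'.
Qed.

Lemma rankP (x0 : T) D (n : nat) : n%:Z <= rank m D <-> rank_ge m D n.
Proof.
case: (is_rank_rank x0 D) => [[neff ->]|[_ [r [-> [rr rmax]]]]].
  split=> [|rn]; first by lia.
  by case: neff; apply/rank_ge0; apply: rank_ge_leq rn.
rewrite lez_nat; split; last exact: rmax.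
by move=> le; apply: rank_ge_leq rr.
Qed.

Lemma rank_geN1 (x0 : T) D : -1 <= rank m D.
Proof. by case: (is_rank_rank x0 D) => [[_ ->]|[_ [r [-> _]]]]. Qed.

Lemma rank_le (x0 : T) D (z : int) :
  -1 <= z -> (forall n : nat, rank_ge m D n -> n%:Z <= z) -> rank m D <= z.
Proof.
move=> z1 H; have [le|] := leP (rank m D) (-1); first by lia.
move=> gt; have rE : rank m D = (absz (rank m D))%:Z by lia.
by rewrite rE; apply: H; apply/(rankP x0); rewrite -rE.
Qed.

Lemma rank_lin_equiv (x0 : T) D D' : lin_equiv m D D' -> rank m D = rank m D'.
Proof.
move=> DD'; apply/eqP; rewrite eq_le; apply/andP; split;
  apply: (rank_le x0) (rank_geN1 x0 _) _ => n rn; apply/(rankP x0);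
  by apply: rank_ge_lin_equiv rn => //; apply: lin_equiv_sym.
Qed.

Lemma rank_sub_eff (x0 : T) D E : effective E -> rank m D <= rank m (dsub D E) + deg E.
Proof.
move=> E0; have := deg_effective E0; have := rank_geN1 x0 (dsub D E) => r1 d0.
apply: (rank_le x0) => [|n rn]; first by lia.
have dE : deg E = (absz (deg E))%:Z by lia.
have [le|gt] := leqP (absz (deg E)) n; last by lia.
rewrite -lerBlDr dE subzn //; apply/(rankP x0); apply: rank_ge_sub dE _ => //.
by rewrite subnK.
Qed.

Lemma rank_sub_le (x0 : T) D E : effective E -> rank m (dsub D E) <= rank m D.
Proof.
move=> E0; apply: (rank_le x0) (rank_geN1 x0 _) _ => n rn; apply/(rankP x0).
by have -> : D = dadd (dsub D E) E by [divisor_ring]; apply: rank_geD.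
Qed.

Lemma rank_deg_lt0 (x0 : T) D : deg D < 0 -> rank m D = -1.
Proof.
move=> dD; apply/eqP; rewrite eq_le rank_geN1 // andbT.
by apply: (rank_le x0) => // n /(rank_ge_deg x0); lia.
Qed.

(* Orienting every edge towards the later endpoint of a fixed ordering of the vertices. *)
Definition indegree x : nat := (\sum_(y | enum_rank y < enum_rank x) m x y)%N.

(** Every edge is counted once at its later endpoint and twice in the double sum, so the halving in
    [genus] is exact. *)
Lemma sum_mult : (\sum_x \sum_y m x y = (\sum_x indegree x).*2)%N.
Proof.
have E : (\sum_x indegree x =
    \sum_x \sum_y if enum_rank x < enum_rank y then m x y else 0)%N.
  rewrite exchange_big; apply: eq_bigr => x _; rewrite -big_mkcond.
  by apply: eq_bigr => y _; rewrite m_sym.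
rewrite -addnn {2}E -big_split; apply: eq_bigr => x _.
rewrite /indegree [X in (_ = X + _)%N]big_mkcond -big_split; apply: eq_bigr => y _ /=.
have [_|_|/val_inj/enum_rank_inj ->] := ltngtP (enum_rank y) (enum_rank x).
- by rewrite addn0.
- by [].
by rewrite m_loopless.
Qed.

Lemma genusE : genus m = (\sum_x indegree x)%N%:Z - #|T|%:Z + 1.
Proof. by rewrite /genus sum_mult -muln2 mulnK. Qed.

(* The witness is [indegree - 1]: firing by any [f], the first vertex at which [f] is maximal loses
   a chip along each edge to an earlier vertex, so it ends in debt. *)
Lemma exists_nonspecial (x0 : T) : exists D, deg D = genus m - 1 /\ ~ equiv_eff m D.
Proof.
pose nu : divisor T := fun x => (indegree x)%:Z - 1.
exists nu; split.
  rewrite /deg sumrB genusE addrK (big_morph Posz PoszD (erefl (0%N%:Z))).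
  by rewrite sumr_const natz.
move=> [D' [D'0 /lin_equivE[f fE]]].
have [x1 _ x1max] := @arg_maxP _ _ _ x0 xpredT f isT.
have [x /eqP fx xmin] := @arg_minnP _ x1 (fun y => f y == f x1) (fun y => enum_rank y) (eqxx _).
have := D'0 x; rewrite fE /nu; suff : laplacian f x <= - (indegree x)%:Z by lia.
rewrite /laplacian /indegree (big_morph Posz PoszD (erefl (0%N%:Z))) -sumrN big_mkcond.
rewrite [leRHS]big_mkcond; apply: ler_sum => y _ /=.
have := x1max y isT; rewrite -fx => le_f.
case: ifP => yx; last by rewrite mulr_ge0_le0 // subr_le0.
have : f y != f x1 by apply: contraL yx => /xmin; rewrite -leqNgt.
by rewrite -fx => ne; have : f y - f x <= -1; [lia|nia].
Qed.

(** * Rank functions and the Weierstrass partition *)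

Definition rank_function v D (b : int) : int := rank m (dadd D (dscale (- b) (pt v))) + 1.

Lemma rank_function_steps v D : unit_steps (rank_function v D).
Proof.
move=> b; rewrite /rank_function.
have -> : dadd D (dscale (- (b + 1)) (pt v)) = dsub (dadd D (dscale (- b) (pt v))) (pt v).
  by divisor_ring.
have := rank_sub_eff v (dadd D (dscale (- b) (pt v))) (@effective_pt v).
have := rank_sub_le v (dadd D (dscale (- b) (pt v))) (@effective_pt v).
by rewrite deg_pt; lia.
Qed.

Lemma rank_function_deg v D (b : int) : deg D < b -> rank_function v D b = 0.
Proof. by move=> db; rewrite /rank_function (rank_deg_lt0 v) // degD degZ deg_pt; lia. Qed.

(** The minimum chosen by [s_idx] exists: some twist has rank at least [i], and negative degree
    bounds such twists below by [- deg D]. *)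
Lemma s_idxP v D (i : nat) :
  (exists b, i%:Z < rank_function v D b) ->
  forall b, (i%:Z < rank_function v D b) = (b <= - s_idx m D v i).
Proof.
move=> [b0 rb0] b.
pose P (l : int) := i%:Z <= rank m (dadd D (dscale l (pt v))).
have PE (l : int) : P l = (i%:Z < rank_function v D (- l)).
  by rewrite /P /rank_function opprK; lia.
have [||l [Pl lmin]] := @int_min_exists P (- deg D).
- by exists (- b0); rewrite PE opprK.
- move=> l; rewrite PE => ri; have [//|lt] := leP (- deg D) l.
  by move: ri; rewrite rank_function_deg; lia.
have ex : exists l, P l /\ forall l', P l' -> l <= l' by exists l.
have [Ps smin] : P (s_idx m D v i) /\ forall l', P l' -> s_idx m D v i <= l'.
  exact: (epsilon_spec (inhabits (0 : int)) _ ex).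
apply/idP/idP => [ri|bs].
  by have := smin (- b); rewrite PE opprK => /(_ ri); lia.
have [] := unit_steps_le (rank_function_steps v D) bs.
by move: Ps; rewrite PE; lia.
Qed.

(** The unreduced [+ 1 - 1] displays the form [chi - 1 - i] with [chi = deg D - genus + 1]. *)
Lemma lambda_excess v D (i : nat) :
  lambda m D v i = - s_idx m D v i - (deg D - genus m + 1 - 1 - i%:Z).
Proof. by rewrite /lambda; lia. Qed.

Lemma profile_s_idxP v D chi : rank_profile (rank_function v D) chi ->
  forall (i : nat) (b : int), (i%:Z < rank_function v D b) = (b <= - s_idx m D v i).
Proof.
move=> [_ _ [L fL]] i; apply: s_idxP.
by exists (Order.min L (chi - i%:Z - 1)); rewrite fL; lia.
Qed.

Lemma lambda_sum_le v D :
  rank_profile (rank_function v D) (deg D - genus m + 1) ->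
  excess_le (rank_function v D) (deg D - genus m + 1) (genus m) ->
  exists N : nat, (forall j : nat, (N <= j)%N -> lambda m D v j = 0) /\
    \sum_(i < N) lambda m D v i <= genus m.
Proof.
move=> pf ef; have [N [w [tj uw _ sumE]]] := excess_sum_conjugate pf (profile_s_idxP pf).
exists N; split=> [j Nj|]; first by rewrite lambda_excess tj // subrr.
by under eq_bigr => i _ do rewrite lambda_excess; rewrite sumE; apply: ef.
Qed.

Lemma equiv_effZ (n : nat) D : equiv_eff m D -> equiv_eff m (dscale n%:Z D).
Proof.
move=> eD; elim: n => [|n IH].
  by apply: effective_equiv_eff => x; rewrite /dscale mul0r.
have -> : dscale n.+1%:Z D = dadd D (dscale n%:Z D).
  by apply: functional_extensionality => x; rewrite /dscale /dadd intS; ring.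
exact: equiv_effD.
Qed.

(** Firing [u] once moves all its chips to the neighbours, one along each edge, and [v] is one of
    them. *)
Lemma equiv_eff_edge u v :
  (0 < m u v)%N -> equiv_eff m (dsub (dscale (\sum_w m u w)%N%:Z (pt u)) (pt v)).
Proof.
move=> uv; set D := dsub _ _.
exists (fun x => D x + firing m u x); split; last first.
  exists (pt u) => x; rewrite (bigD1 u) //= /pt eqxx mul1r big1 ?addr0 //.
  by move=> w /negPf ->; rewrite mul0r.
move=> x; rewrite /D /dsub /dscale /pt /firing /valence.
have [->|xu] := eqVneq x u; last first.
  rewrite mulr0 sub0r; have [->|_] := eqVneq x v; last by lia.
  by lia.
have /negPf -> : u != v by apply: contraL uv => /eqP <-; rewrite m_loopless.
by rewrite mulr1 subr0 (big_morph Posz PoszD (erefl (0%N%:Z))) subrr.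
Qed.

(** * Large multiples of a vertex and asymptotic Riemann-Roch *)

Hypothesis m_connected : forall x y, connect (fun a b => (0 < m a b)%N) x y.

(** Induction along a path: if [N] chips at [v] can produce one at [w], and [c] chips at [w] one at
    the next vertex, then [c * N] chips at [v] suffice. *)
Lemma equiv_eff_multiple v x : exists N : nat, equiv_eff m (dsub (dscale N%:Z (pt v)) (pt x)).
Proof.
have /connectP[p pP ->] := m_connected v x; elim/last_ind: p pP => [|p z IH] /=.
  move=> _; exists 1%N; apply: effective_equiv_eff => y.
  by rewrite /dsub /dscale mul1r subrr.
rewrite rcons_path last_rcons => /andP[/IH[N eN] /equiv_eff_edge ez].
set w := last v p in eN ez; set c := (\sum_y m w y)%N in ez.
exists (c * N)%N.
have -> : dsub (dscale (c * N)%N%:Z (pt v)) (pt z) =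
    dadd (dscale c%:Z (dsub (dscale N%:Z (pt v)) (pt w))) (dsub (dscale c%:Z (pt w)) (pt z)).
  by apply: functional_extensionality => y; rewrite /dadd /dsub /dscale PoszM; ring.
by apply: equiv_effD ez; apply: equiv_effZ.
Qed.

Lemma equiv_eff_multiple_unif v :
  exists N : nat, forall x, equiv_eff m (dsub (dscale N%:Z (pt v)) (pt x)).
Proof.
suff [N HN] : exists N : nat,
    forall x, x \in enum T -> equiv_eff m (dsub (dscale N%:Z (pt v)) (pt x)).
  by exists N => x; apply: HN; rewrite mem_enum.
elim: (enum T) => [|y s [N HN]]; first by exists 0%N.
have [M HM] := equiv_eff_multiple v y; exists (M + N)%N => x.
have add (a b : nat) : equiv_eff m (dsub (dscale a%:Z (pt v)) (pt x)) ->
    equiv_eff m (dsub (dscale (a + b)%N%:Z (pt v)) (pt x)).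
  have -> : dsub (dscale (a + b)%N%:Z (pt v)) (pt x) =
      dadd (dsub (dscale a%:Z (pt v)) (pt x)) (dscale b%:Z (pt v)).
    by apply: functional_extensionality => z; rewrite /dadd /dsub /dscale PoszD; ring.
  move=> ea; apply: equiv_effD ea _; apply: effective_equiv_eff.
  by apply: effectiveZ; apply: effective_pt.
rewrite inE => /orP[/eqP xy|/HN eN].
  by apply: add; rewrite xy.
by rewrite addnC; apply: add.
Qed.

(** With [N] as in [equiv_eff_multiple_unif], every [N] further chips at [v] raise the rank by at
    least one. *)
Lemma rank_ge_large v D (i : nat) :
  exists M : nat, forall l : int, M%:Z <= l -> rank_ge m (dadd D (dscale l (pt v))) i.
Proof.
have [N HN] := equiv_eff_multiple_unif v.
have step F n : rank_ge m F n -> rank_ge m (dadd F (dscale N%:Z (pt v))) n.+1.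
  move=> rF E E0 dE.
  have [x Ex] : exists x, 0 < E x.
    apply: NNPP => no; suff : deg E = 0 by lia.
    rewrite /deg big1 // => x _; apply/eqP; rewrite eq_le E0 andbT leNgt.
    by apply/negP => Ex; case: no; exists x.
  have -> : dsub (dadd F (dscale N%:Z (pt v))) E =
      dadd (dsub F (dsub E (pt x))) (dsub (dscale N%:Z (pt v)) (pt x)).
    by divisor_ring.
  apply: equiv_effD (HN x); apply: rF; last by rewrite degB deg_pt dE; lia.
  move=> y; rewrite /dsub /pt; case: eqP => [->|_]; last by rewrite subr0.
  by lia.
have multi F n j : rank_ge m F n -> rank_ge m (dadd F (dscale (j * N)%N%:Z (pt v))) (j + n).
  move=> rF; elim: j => [|j IH].
    have -> // : dadd F (dscale (0 * N)%N%:Z (pt v)) = F.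
    by apply: functional_extensionality => x; rewrite /dadd /dscale mul0r addr0.
  have -> : dadd F (dscale (j.+1 * N)%N%:Z (pt v)) =
      dadd (dadd F (dscale (j * N)%N%:Z (pt v))) (dscale N%:Z (pt v)).
    by apply: functional_extensionality => x; rewrite /dadd /dscale mulSn PoszD; ring.
  exact: step.
(* [D = Dp - Dn]; removing [Dn] costs at most its degree [n] in rank, hence the target [i + n]. *)
pose Dn : divisor T := fun x => Order.max 0 (- D x).
pose Dp : divisor T := fun x => Order.max 0 (D x).
have Dn0 : effective Dn by move=> x; rewrite /Dn; lia.
have Dp0 : effective Dp by move=> x; rewrite /Dp; lia.
have dn : deg Dn = (absz (deg Dn))%:Z by have := deg_effective Dn0; lia.
set n := absz (deg Dn) in dn.
have r0 : rank_ge m (dscale 0 D) 0.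
  apply/rank_ge0; apply: effective_equiv_eff => x.
  by rewrite /dscale mul0r.
exists ((i + n) * N)%N => l Ml.
have -> : dadd D (dscale l (pt v)) =
    dadd (dadd (dsub (dadd (dscale 0 D) (dscale ((i + n) * N)%N%:Z (pt v))) Dn) Dp)
         (dscale (absz (l - ((i + n) * N)%N%:Z)%R)%:Z (pt v)).
  apply: functional_extensionality => x; rewrite /dadd /dsub /dscale.
  have -> : (absz (l - ((i + n) * N)%N%:Z)%R)%:Z = l - ((i + n) * N)%N%:Z by lia.
  have -> : D x = Dp x - Dn x by rewrite /Dp /Dn; lia.
  ring.
apply: rank_geD; first by apply: effectiveZ; apply: effective_pt.
apply: rank_geD => //; apply: rank_ge_sub dn _ => //.
by rewrite -[X in rank_ge _ _ X]addn0; apply: multi.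
Qed.

Lemma BN_general_excess v D :
  BN_general m v ->
  rank_profile (rank_function v D) (deg D - genus m + 1) /\
  excess_le (rank_function v D) (deg D - genus m + 1) (genus m).
Proof.
move=> /(_ D) [N [lamN sumN]]; set chi := deg D - genus m + 1.
have ft (i : nat) (b : int) : (i%:Z < rank_function v D b) = (b <= - s_idx m D v i).
  apply: s_idxP; have [M HM] := rank_ge_large v D i.
  exists (- M%:Z); rewrite /rank_function opprK.
  by have /(rankP v) := HM M (lexx _); lia.
have pf : rank_profile (rank_function v D) chi.
  split; first exact: rank_function_steps.
    by exists (deg D + 1) => b bd; apply: rank_function_deg; lia.
  (* Beyond [N] the parts vanish, so [t j = chi - 1 - j]; the rows [j] and [j + 1] with
     [j = chi - 1 - b] pin [f b] to [chi - b]. *)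
  exists (chi - 1 - N%:Z) => b bL.
  have [j jE] : exists j : nat, chi - 1 - b = j%:Z by exists (absz (chi - 1 - b)%R); lia.
  have tE (i : nat) : (N <= i)%N -> - s_idx m D v i = chi - 1 - i%:Z.
    by move=> /lamN; rewrite lambda_excess /chi; lia.
  by have := ft j b; have := ft j.+1 b; rewrite !tE; lia.
split=> // s us.
have [N' [w [tj _ wout sumE]]] := excess_sum_conjugate pf ft.
apply: le_trans (_ : \sum_(b <- w) excess (rank_function v D) chi b <= _).
  apply: sum_le_support => // [b|b _]; [exact: excess_ge0 | exact: wout].
rewrite -sumE; apply: le_trans sumN.
have lamE (i : nat) : lambda m D v i = - s_idx m D v i - (chi - 1 - i%:Z) by exact: lambda_excess.
under [leRHS]eq_bigr => i _ do rewrite lamE.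
(* The two cut-offs [N] and [N'] may differ; both sums are extended by zeros to the larger one. *)
have ext (M M' : nat) : (M <= M')%N ->
    (forall j, (M <= j)%N -> - s_idx m D v j - (chi - 1 - j%:Z) = 0) ->
    \sum_(i < M) (- s_idx m D v i - (chi - 1 - i%:Z))
    = \sum_(i < M') (- s_idx m D v i - (chi - 1 - i%:Z)).
  move=> le z; rewrite -!(big_mkord xpredT (fun i => - s_idx m D v i - (chi - 1 - i%:Z))).
  rewrite (big_cat_nat _ le) //= [X in _ = _ + X]big_nat_cond [X in _ = _ + X]big1 ?addr0 // => i /andP[/andP[Mi _] _].
  exact: z.
rewrite (@ext N' (maxn N N')) ?(@ext N (maxn N N')) ?leq_maxl ?leq_maxr //.
  by move=> j /lamN; rewrite lamE.
by move=> j /tj ->; rewrite subrr.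
Qed.

(** For large [l] the divisor [D + l v] is equivalent to [nu + E] with [E] effective and [nu] of
    degree [g - 1] and rank [-1]; adding [E] raises the rank by at most [deg E]. *)
Lemma rank_le_large v D :
  exists M : nat, forall l : int, M%:Z <= l ->
    rank m (dadd D (dscale l (pt v))) <= deg D + l - genus m.
Proof.
have [nu [dnu nnu]] := exists_nonspecial v.
have [M HM] := rank_ge_large v (dsub D nu) 0; exists M => l Ml.
have /rank_ge0 [E [E0 DE]] := HM l Ml.
have := rank_sub_eff v (dadd D (dscale l (pt v))) E0.
have -> : rank m (dsub (dadd D (dscale l (pt v))) E) = rank m nu.
  apply: (rank_lin_equiv v); case/lin_equivE: DE => f fE; apply/lin_equivE.
  by exists f => x; rewrite /dsub fE /dadd /dsub; ring.
have -> : rank m nu = -1.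
  by apply/eqP; rewrite eq_le rank_geN1 // andbT; apply: (rank_le v) => // n rn;
     case: nnu; apply/rank_ge0; apply: rank_ge_leq rn.
by rewrite (deg_lin_equiv DE) degD degB degZ deg_pt; lia.
Qed.

(** Every [D] is equivalent to [M v - E] with [E] effective, and removing [E] lowers the rank by at
    most [deg E]. *)
Lemma rank_ge_deg_genus v (g : int) :
  (forall n : nat, n%:Z - g <= rank m (dscale n%:Z (pt v))) ->
  forall D, deg D - g <= rank m D.
Proof.
move=> H D.
have [M HM] := rank_ge_large v (dscale (-1) D) 0.
have /rank_ge0 [E [E0 DE]] := HM M (lexx _).
have := rank_sub_eff v (dscale M%:Z (pt v)) E0; have := H M.
have -> : rank m (dsub (dscale M%:Z (pt v)) E) = rank m D.
  apply: (rank_lin_equiv v); case/lin_equivE: DE => f fE; apply/lin_equivE.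
  by exists f => x; rewrite /dsub fE /dadd /dscale; ring.
by rewrite (deg_lin_equiv DE) degD !degZ deg_pt; lia.
Qed.


End ChipFiringTheory.

(** * Transmission *)

Section Transmission.
Variables (T : finType) (m : T -> T -> nat).
Hypotheses (m_sym : forall x y, m x y = m y x) (m_loopless : forall x, m x x = 0%N).
Implicit Types (D E : divisor T).
Variables (u v : T).

Definition twist_rank D (b a : int) : int := rank m (twist u v D a (- b)) + 1.

Lemma deg_twist D (a b : int) : deg (twist u v D a b) = deg D + a + b.
Proof. by rewrite /twist !degD !degZ !deg_pt !mulr1. Qed.

Lemma Delta_twist D (a b : int) :
  Delta m u v (twist u v D a (- b)) =
  twist_rank D b a - twist_rank D b (a - 1) - twist_rank D (b + 1) a
  + twist_rank D (b + 1) (a - 1).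
Proof.
rewrite /Delta /twist_rank.
have -> : dsub (dsub (twist u v D a (- b)) (pt u)) (pt v) = twist u v D (a - 1) (- (b + 1)).
  by divisor_ring.
have -> : dsub (twist u v D a (- b)) (pt v) = twist u v D a (- (b + 1)) by divisor_ring.
have -> : dsub (twist u v D a (- b)) (pt u) = twist u v D (a - 1) (- b) by divisor_ring.
by ring.
Qed.

Lemma twist_rank_deg D (a b : int) : deg D + a < b -> twist_rank D b a = 0.
Proof. by move=> lt; rewrite /twist_rank rank_deg_lt0 // deg_twist; lia. Qed.

(** [Delta] is a mixed second difference; it is summed over [a], starting where negative degree
    makes both ranks [-1]. *)
Lemma transmission_transmits D tau :
  is_transmission m u v D tau -> transmits tau (twist_rank D).
Proof.
move=> [_ tD]; split=> [b a|a]; last first.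
  by exists (deg D + a + 1) => b lb; apply: twist_rank_deg; lia.
pose a0 : int := Order.min (tau b - 1) (b - deg D - 1).
have low (x : int) : x <= a0 -> twist_rank D b x = twist_rank D (b + 1) x + (tau b <= x)%R%:Z.
  by move=> lx; rewrite !twist_rank_deg; lia.
have [|lt] := leP a a0; first exact: low.
move: a {lt}(ltW lt); apply: int_up_ind => [|a _ IH]; first exact: low.
by have := tD (a + 1) b; rewrite Delta_twist addrK IH; lia.
Qed.

Lemma twist_rank_shift D (a b j : int) :
  lin_equiv m (dscale j (pt u)) (dscale j (pt v)) ->
  twist_rank D (b + j) (a + j) = twist_rank D b a.
Proof.
move=> e; rewrite /twist_rank (@rank_lin_equiv _ m _ _ u _ (twist u v D a (- b))) //.
have -> : twist u v D (a + j) (- (b + j)) =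
    dadd (dscale j (pt u)) (twist u v D a (- b - j)) by divisor_ring.
have -> : twist u v D a (- b) = dadd (dscale j (pt v)) (twist u v D a (- b - j)).
  by divisor_ring.
by apply: lin_equivD => //; apply: lin_equiv_refl.
Qed.

(** Multiples [j] of [k] satisfy [j u ~ j v], so [Delta] is unchanged when [a] and [b] both shift by
    [j]. *)
Lemma transmission_periodic D tau (k b j : int) :
  lin_equiv m (dscale k (pt u)) (dscale k (pt v)) ->
  is_transmission m u v D tau -> (k %| j)%Z -> tau (b + j) = tau b + j.
Proof.
move=> kuv [_ tD] /dvdzP[q jE].
have juv : lin_equiv m (dscale j (pt u)) (dscale j (pt v)).
  case: kuv => f fE; exists (fun x => q * f x) => x.
  move: (fE x); rewrite /dscale jE -!mulrA => ->.
  by rewrite mulrDr mulr_sumr; congr (_ + _); apply: eq_bigr => w _; rewrite mulrA.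
have := tD (tau b + j) (b + j); rewrite Delta_twist.
have -> : tau b + j - 1 = tau b - 1 + j by ring.
have -> : b + j + 1 = b + 1 + j by ring.
by rewrite !twist_rank_shift // -Delta_twist tD eqxx; lia.
Qed.

(* For [D = 0] one has [tau 0 <= 0], so every [b < 0] with [tau b > 0] gives an inversion [(b, 0)];
   these are pairwise inequivalent, and counting them bounds the deficiency of [r(n v)]. *)
Lemma k_general_rank_ge (k n : nat) :
  k_general_transmission m u v k -> n%:Z - genus m <= rank m (dscale n%:Z (pt v)).
Proof.
move=> [_ _ /(_ (fun=> 0)) [tau [tr [s [sg cov]]]]].
set D : divisor T := fun=> 0 in tr.
have [rec _] := transmission_transmits tr.
have dD : deg D = 0 by rewrite /deg big1.
have r10 : twist_rank D 1 0 = 0 by rewrite twist_rank_deg // dD.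
have r00 : 1 <= twist_rank D 0 0.
  rewrite /twist_rank -subr_ge0 addrK; apply/(rankP m_sym m_loopless u _ 0).
  apply/rank_ge0 => //; by apply: effective_equiv_eff.
have t0 : tau 0 <= 0 by have := rec 0 0; rewrite (_ : 0 + 1 = 1) // r10; lia.
pose X (j : nat) := [seq b <- [seq - (i.+1)%:Z | i <- iota 0 j] | 0 < tau b].
(* Each added chip at [v] raises the rank unless the new [b] has [tau b > 0], so [X j] counts
   [j - r(j v)]. *)
have sizeX j : (size (X j))%:Z = j%:Z + 1 - twist_rank D (- j%:Z) 0.
  elim: j => [|j IH]; first by have := rec 0 0; rewrite (_ : 0 + 1 = 1) // r10 t0 => ->.
  rewrite /X -addn1 iotaD map_cat filter_cat size_cat PoszD IH add0n /=.
  have := rec (- j.+1%:Z) 0; have -> : - j.+1%:Z + 1 = - j%:Z by lia.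
  have -> : - (j + 1)%N%:Z = - j.+1%:Z by lia.
  by case: ifP => /=; lia.
have uX : uniq (X n).
  by rewrite filter_uniq // map_inj_uniq ?iota_uniq // => i j; lia.
(* Equivalent pairs have equal coordinate differences, so [b] can be read off any representative of
   the class of [(b, 0)]. *)
have subX : {subset X n <= [seq q.1 - q.2 | q <- s]}.
  move=> b; rewrite mem_filter => /andP[tb /mapP[i _ bE]].
  have [|q qs [/= e _]] := cov (b, 0); first by split=> /=; lia.
  by apply/mapP; exists q => //; lia.
have := uniq_leq_size uX subX; rewrite size_map => le.
have -> : dscale n%:Z (pt v) = twist u v D 0 (- (- n%:Z)) by divisor_ring.
have -> : rank m (twist u v D 0 (- - n%:Z)) = n%:Z - (size (X n))%:Z.
  by rewrite sizeX /twist_rank; ring.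
by move: le sg; rewrite -lez_nat => le /(le_trans le); rewrite lerD2l lerN2.
Qed.

End Transmission.

(** * Vertex gluing *)

Section RankWitness.
Variables (T : finType) (m : T -> T -> nat).
Hypotheses (m_sym : forall x y, m x y = m y x) (m_loopless : forall x, m x x = 0%N).

Lemma rank_witness (x0 : T) (D : divisor T) :
  exists E, [/\ effective E, deg E = rank m D + 1 & ~ equiv_eff m (dsub D E)].
Proof.
have r1 := rank_geN1 m_sym m_loopless x0 D.
have rE : rank m D + 1 = (absz (rank m D + 1)%R)%:Z by lia.
apply: NNPP => no.
suff /(rankP m_sym m_loopless x0) : rank_ge m D (absz (rank m D + 1)%R) by lia.
move=> E E0 dE; apply: NNPP => nE; case: no; exists E; split=> //.
by rewrite rE.
Qed.

Lemma rank_lt_deg (x0 : T) (D E : divisor T) :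
  effective E -> ~ equiv_eff m (dsub D E) -> rank m D < deg E.
Proof.
move=> E0 nE; have := rank_sub_eff m_sym m_loopless x0 D E0.
suff -> : rank m (dsub D E) = -1 by lia.
apply/eqP; rewrite eq_le rank_geN1 // andbT; apply: rank_le => // n rn.
by case: nE; apply/rank_ge0 => //; apply: rank_ge_leq rn.
Qed.

End RankWitness.

(** * Pushing divisors and multiplicities along a vertex map *)

Section Pushforward.
Variables (S V : finType) (h : S -> V).

Definition pushforward (E : divisor S) : divisor V :=
  fun p => \sum_x (h x == p)%:Z * E x.

(** The multiplicity on a gluing is the sum of two such terms, one for each inclusion. *)
Definition push_mult (m : S -> S -> nat) (p q : V) : nat :=
  (\sum_x \sum_y ((h x == p) && (h y == q)) * m x y)%N.

Lemma sum_indicator (x : V) (F : V -> int) : \sum_q (x == q)%:Z * F q = F x.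
Proof.
rewrite (bigD1 x) //= eqxx mul1r big1 ?addr0 // => q.
by rewrite eq_sym => /negPf ->; rewrite mul0r.
Qed.

Lemma deg_pushforward E : deg (pushforward E) = deg E.
Proof.
rewrite /deg /pushforward exchange_big; apply: eq_bigr => x _.
exact: (sum_indicator (h x) (fun=> E x)).
Qed.

Lemma push_multE m p q :
  (push_mult m p q)%:Z = \sum_x \sum_y (h x == p)%:Z * (h y == q)%:Z * (m x y)%:Z.
Proof.
rewrite (big_morph Posz PoszD (erefl (0%N%:Z))); apply: eq_bigr => x _.
rewrite (big_morph Posz PoszD (erefl (0%N%:Z))); apply: eq_bigr => y _.
by rewrite PoszM -mulnb PoszM.
Qed.

Lemma sum_push_mult m p (F : V -> int) :
  \sum_q (push_mult m p q)%:Z * F q = \sum_x (h x == p)%:Z * \sum_y (m x y)%:Z * F (h y).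
Proof.
under eq_bigr => q _ do rewrite push_multE mulr_suml.
rewrite exchange_big; apply: eq_bigr => x _ /=.
under eq_bigr => q _ do rewrite mulr_suml.
rewrite exchange_big mulr_sumr; apply: eq_bigr => y _ /=.
rewrite -(sum_indicator (h y) F) !mulr_sumr; apply: eq_bigr => q _; ring.
Qed.

Lemma laplacian_push_mult m (f : V -> int) p :
  laplacian (push_mult m) f p = pushforward (laplacian m (f \o h)) p.
Proof.
rewrite /laplacian (sum_push_mult m p (fun q => f q - f p)); apply: eq_bigr => x _.
by have [<-|] := eqVneq (h x) p; rewrite ?mul0r.
Qed.

Lemma sum_sum_push_mult m : (\sum_p \sum_q push_mult m p q = \sum_x \sum_y m x y)%N.
Proof.
rewrite /push_mult.
under eq_bigr => p _ do rewrite exchange_big.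
rewrite exchange_big; apply: eq_bigr => x _ /=.
under eq_bigr => p _ do rewrite exchange_big.
rewrite exchange_big; apply: eq_bigr => y _ /=.
under eq_bigr => p _ do (under eq_bigr => q _ do rewrite -mulnb mulnAC; rewrite -big_distrr).
rewrite (bigD1 (h x)) //= [X in (_ + X)%N]big1 ?addn0.
  rewrite eqxx mul1n (bigD1 (h y)) //= eqxx big1 ?addn0 ?muln1 // => q.
  by rewrite eq_sym => /negPf ->.
by move=> p; rewrite eq_sym => /negPf ->; rewrite mul0n.
Qed.

Lemma push_mult_sym m : (forall x y, m x y = m y x) ->
  forall p q, push_mult m p q = push_mult m q p.
Proof.
move=> ms p q; rewrite /push_mult exchange_big; apply: eq_bigr => x _.
by apply: eq_bigr => y _; rewrite andbC ms.
Qed.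

Lemma push_mult_loopless m : injective h -> (forall x, m x x = 0%N) ->
  forall p, push_mult m p p = 0%N.
Proof.
move=> hi ml p; rewrite /push_mult big1 // => x _; rewrite big1 // => y _.
by case: eqP => [xp|]; case: eqP => [yp|] //; rewrite (hi x y) ?ml // xp yp.
Qed.

End Pushforward.

Section Gluing.
Variables (T1 T2 : finType) (v1 : T1) (u2 : T2) (m1 : T1 -> T1 -> nat) (m2 : T2 -> T2 -> nat).
Hypotheses (m1_sym : forall x y, m1 x y = m1 y x) (m1_loopless : forall x, m1 x x = 0%N).
Hypotheses (m2_sym : forall x y, m2 x y = m2 y x) (m2_loopless : forall x, m2 x x = 0%N).

Local Notation V := (glueV T1 u2).
Local Notation i1 := (@glue1 T1 T2 u2).
Local Notation i2 := (glue2 v1 u2 : T2 -> V).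
Local Notation mG := (glue_mult v1 u2 m1 m2).

Lemma glue2_base : i2 u2 = inl v1.
Proof. by rewrite /glue2 insubF // eqxx. Qed.

Lemma glue2_val (y : {y : T2 | y != u2}) : i2 (val y) = inr y.
Proof. by rewrite /glue2 valK. Qed.

Lemma glue2_cases y : y = u2 \/ exists z : {y : T2 | y != u2}, y = val z.
Proof. by have [->|yu] := eqVneq y u2; [left | right; exists (Sub y yu)]. Qed.

Lemma glue2_inj : injective i2.
Proof.
move=> x y; have [->|[x' ->]] := glue2_cases x; have [->|[y' ->]] := glue2_cases y;
  by rewrite ?glue2_base ?glue2_val // => -[->].
Qed.

(** The decomposition is not unique: chips at the common vertex may be assigned to either side. *)
Definition glueD (D1 : divisor T1) (D2 : divisor T2) : divisor V :=
  dadd (pushforward i1 D1) (pushforward i2 D2).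

Lemma glueD_inl D1 D2 x : glueD D1 D2 (inl x) = D1 x + (x == v1)%:Z * D2 u2.
Proof.
rewrite /glueD /dadd /pushforward; congr (_ + _).
  rewrite (bigD1 x) //= eqxx mul1r big1 ?addr0 // => y /negPf yx.
  by rewrite (_ : (i1 y == inl x) = (y == x)) ?yx ?mul0r.
rewrite (bigD1 u2) //= glue2_base [in X in X + _](_ : (inl v1 == inl x) = (x == v1)); last exact: eq_sym.
rewrite big1 ?addr0 // => y yu.
by have -> : y = val (Sub y yu : {y : T2 | y != u2}) by []; rewrite glue2_val mul0r.
Qed.

Lemma glueD_inr D1 D2 y : glueD D1 D2 (inr y) = D2 (val y).
Proof.
rewrite /glueD /dadd /pushforward big1 ?add0r; last by move=> x _; rewrite mul0r.
rewrite (bigD1 (val y)) //= glue2_val eqxx mul1r big1 ?addr0 // => z zy.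
by rewrite -glue2_val (inj_eq glue2_inj) (negPf zy) mul0r.
Qed.

Lemma glue_mult_push p q : mG p q = (push_mult i1 m1 p q + push_mult i2 m2 p q)%N.
Proof. by []. Qed.

Lemma glue_sym p q : mG p q = mG q p.
Proof. by rewrite !glue_mult_push (push_mult_sym _ m1_sym) (push_mult_sym _ m2_sym). Qed.

Lemma glue_loopless p : mG p p = 0%N.
Proof.
rewrite glue_mult_push (push_mult_loopless _ m1_loopless) ?(push_mult_loopless glue2_inj m2_loopless) //.
by move=> x y [].
Qed.

Lemma laplacian_glue (f : V -> int) p :
  laplacian mG f p = glueD (laplacian m1 (f \o i1)) (laplacian m2 (f \o i2)) p.
Proof.
rewrite /glueD /dadd -!laplacian_push_mult /laplacian -big_split /=.
by apply: eq_bigr => q _; rewrite glue_mult_push PoszD mulrDl.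
Qed.

Lemma deg_glueD D1 D2 : deg (glueD D1 D2) = deg D1 + deg D2.
Proof. by rewrite degD !deg_pushforward. Qed.

Lemma genus_glue : genus mG = genus m1 + genus m2.
Proof.
rewrite /genus.
have -> : (\sum_p \sum_q mG p q = \sum_x \sum_y m1 x y + \sum_x \sum_y m2 x y)%N.
  rewrite -(sum_sum_push_mult i1) -(sum_sum_push_mult i2) -big_split /=.
  by apply: eq_bigr => p _; rewrite -big_split.
rewrite (sum_mult m1_sym m1_loopless) (sum_mult m2_sym m2_loopless) -doubleD -!muln2 !mulnK //.
have -> : #|V| = (#|T1| + #|T2|.-1)%N by rewrite card_sum card_sig cardC1.
have : (0 < #|T2|)%N by apply/card_gt0P; exists u2.
by lia.
Qed.

(** All chips at the common vertex are assigned to the first side. *)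
Lemma glueD_split (D : divisor V) : exists D1 D2,
  D = glueD D1 D2 /\ (effective D -> effective D1 /\ effective D2).
Proof.
exists (D \o i1), (fun y => if y == u2 then 0 else D (i2 y)); split.
  apply: functional_extensionality => -[x|y];
    rewrite ?glueD_inl ?glueD_inr ?eqxx ?mulr0 ?addr0 //.
  by rewrite (negPf (valP y)) glue2_val.
by move=> D0; split=> [x|y]; [apply: D0 | case: ifP].
Qed.

Lemma glueDB D1 D2 E1 E2 :
  dsub (glueD D1 D2) (glueD E1 E2) = glueD (dsub D1 E1) (dsub D2 E2).
Proof.
apply: functional_extensionality => -[x|y];
  rewrite [LHS]/dsub ?glueD_inl ?glueD_inr /dsub //; ring.
Qed.

Lemma glueD_add_pt2 D1 D2 y (b : int) :
  dadd (glueD D1 D2) (dscale b (pt (i2 y))) = glueD D1 (dadd D2 (dscale b (pt y))).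
Proof.
apply: functional_extensionality => -[x|z]; rewrite [LHS]/dadd ?glueD_inl ?glueD_inr /dadd /dscale /pt.
  have [->|[z ->]] := glue2_cases y.
    rewrite glue2_base eqxx (_ : (inl x == inl v1) = (x == v1)) // mulr1; ring.
  rewrite glue2_val (_ : (inl x == inr z) = false) // [u2 == _]eq_sym (negPf (valP z)) !mulr0; ring.
by rewrite -glue2_val (inj_eq glue2_inj).
Qed.

(** Firing scripts restrict to both sides, so the sides interact only through the [a] chips
    transferred at the common vertex. *)
Lemma equiv_eff_glue D1 D2 :
  equiv_eff mG (glueD D1 D2) <->
  exists a : int, equiv_eff m1 (dadd D1 (dscale (- a) (pt v1))) /\
                  equiv_eff m2 (dadd D2 (dscale a (pt u2))).
Proof.
split.
  move=> [F [F0 /(lin_equivE glue_sym glue_loopless)[f fE]]].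
  pose D1' x := D1 x + laplacian m1 (f \o i1) x.
  pose D2' y := D2 y + laplacian m2 (f \o i2) y.
  have FE p : F p = glueD D1' D2' p.
    rewrite fE laplacian_glue; case: p => [x|y]; rewrite ?glueD_inl ?glueD_inr // /D1' /D2'; ring.
  (* All chips of the first side at [v1] after firing are handed over to [u2]. *)
  exists (D1' v1); split.
    exists (fun x => D1' x - D1' v1 * pt v1 x); split; last first.
      apply/lin_equivE => //; exists (f \o i1) => x; rewrite /dadd /dscale /D1'; ring.
    move=> x; rewrite /pt; have [->|xv] := eqVneq x v1; first by rewrite mulr1 subrr.
    by have := F0 (inl x); rewrite FE glueD_inl (negPf xv) mul0r addr0 mulr0 subr0.
  exists (fun y => D2' y + D1' v1 * pt u2 y); split; last first.
    apply/lin_equivE => //; exists (f \o i2) => x; rewrite /dadd /dscale /D2'; ring.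
  move=> y; rewrite /pt; have [->|[z ->]] := glue2_cases y.
    by have := F0 (inl v1); rewrite FE glueD_inl !eqxx mul1r mulr1 addrC.
  by have := F0 (inr z); rewrite FE glueD_inr (negPf (valP z)) mulr0 addr0.
move=> [a [[F1 [F10 /(lin_equivE m1_sym m1_loopless)[f1 f1E]]]
           [F2 [F20 /(lin_equivE m2_sym m2_loopless)[f2 f2E]]]]].
(* Subtracting constants makes both scripts vanish at the common vertex, so they glue. *)
pose f (p : V) := match p with inl x => f1 x - f1 v1 | inr y => f2 (val y) - f2 u2 end.
have fi2 : f \o i2 = fun y => f2 y - f2 u2.
  apply: functional_extensionality => y /=; have [->|[z ->]] := glue2_cases y.
    by rewrite glue2_base /= !subrr.
  by rewrite glue2_val.
exists (glueD F1 F2); split.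
  move=> [x|y]; rewrite ?glueD_inl ?glueD_inr //.
  by apply: addr_ge0 => //; apply: mulr_ge0.
apply/(lin_equivE glue_sym glue_loopless); exists f => p.
rewrite laplacian_glue fi2.
have -> : f \o i1 = fun x => f1 x - f1 v1 by [].
case: p => [x|y]; rewrite ?glueD_inl ?glueD_inr !laplacian_cst ?f1E ?f2E /dadd /dscale /pt ?eqxx.
  rewrite mulr1; ring.
by rewrite (negPf (valP y)) mulr0 addr0.
Qed.

Hypothesis m1_connected : forall x y, connect (fun a b => (0 < m1 a b)%N) x y.

(** Obstructions [E1] and [E2] to effectivity glue to an obstruction: a transfer of [c >= a] chips
    would contradict [E1], one of [c <= a - 1] chips [E2]. *)
Lemma rank_glue_le D1 D2 (a : int) :
  rank mG (glueD D1 D2) + 1 <=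
  (rank m1 (dadd D1 (dscale (- a) (pt v1))) + 1) + (rank m2 (dadd D2 (dscale (a - 1) (pt u2))) + 1).
Proof.
have [E1 [E10 <- nE1]] := rank_witness m1_sym m1_loopless v1 (dadd D1 (dscale (- a) (pt v1))).
have [E2 [E20 <- nE2]] := rank_witness m2_sym m2_loopless u2 (dadd D2 (dscale (a - 1) (pt u2))).
rewrite -deg_glueD -ltzD1 ltrD2r; apply: (rank_lt_deg glue_sym glue_loopless (inl v1)).
  move=> [x|y]; rewrite ?glueD_inl ?glueD_inr //.
  by apply: addr_ge0 => //; apply: mulr_ge0.
rewrite glueDB => /equiv_eff_glue[c [e1 e2]].
have [ac|ca] := leP a c.
  case: nE1.
  have -> : dsub (dadd D1 (dscale (- a) (pt v1))) E1 =
      dadd (dadd (dsub D1 E1) (dscale (- c) (pt v1))) (dscale (c - a) (pt v1)) by divisor_ring.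
  apply: equiv_effD e1 _ => //; apply: effective_equiv_eff => // x.
  by apply: mulr_ge0 => //; lia.
case: nE2.
have -> : dsub (dadd D2 (dscale (a - 1) (pt u2))) E2 =
    dadd (dadd (dsub D2 E2) (dscale c (pt u2))) (dscale (a - 1 - c) (pt u2)) by divisor_ring.
apply: equiv_effD e2 _ => //; apply: effective_equiv_eff => // x.
by apply: mulr_ge0 => //; lia.
Qed.

(** Split an obstruction of degree [r + 1] as [E1], [E2] and take the least [a] for which
    [D1 - E1 - a v1] is not equivalent to an effective divisor. Then a transfer of [a - 1] chips
    succeeds on the first side, so it must fail on the second. *)
Lemma rank_glue_attained D1 D2 : exists a : int,
  (rank m1 (dadd D1 (dscale (- a) (pt v1))) + 1) + (rank m2 (dadd D2 (dscale (a - 1) (pt u2))) + 1)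
  <= rank mG (glueD D1 D2) + 1.
Proof.
have [E [E0 <-]] := rank_witness glue_sym glue_loopless (inl v1) (glueD D1 D2).
have [E1 [E2 [EE /(_ E0) [E10 E20]]]] := glueD_split E.
rewrite EE glueDB deg_glueD => nE.
pose P (a : int) := ~ equiv_eff m1 (dadd (dsub D1 E1) (dscale (- a) (pt v1))).
have [M HM] := rank_ge_large m1_sym m1_loopless m1_connected v1 (dsub D1 E1) 0.
have [||a [Pa amin]] := @int_min_exists P (- M%:Z).
- exists (deg (dsub D1 E1) + 1) => /(equiv_eff_deg m1_sym m1_loopless).
  by rewrite degD degZ deg_pt; lia.
- move=> a Pa; have [//|lt] := leP (- M%:Z) a.
  by case: Pa; apply/rank_ge0 => //; apply: HM; lia.
exists a; apply: lerD; rewrite lezD1.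
  apply: rank_lt_deg => //.
  by have -> : dsub (dadd D1 (dscale (- a) (pt v1))) E1 =
    dadd (dsub D1 E1) (dscale (- a) (pt v1)) by divisor_ring.
apply: rank_lt_deg => //.
have -> : dsub (dadd D2 (dscale (a - 1) (pt u2))) E2 =
    dadd (dsub D2 E2) (dscale (a - 1) (pt u2)) by divisor_ring.
move=> e2; case: nE; apply/equiv_eff_glue; exists (a - 1); split=> //.
by apply: NNPP => /amin; lia.
Qed.

End Gluing.

(** * Brill-Noether generality of the vertex gluing *)

Theorem mainTheorem9 (T1 T2 : finType) (m1 : T1 -> T1 -> nat) (m2 : T2 -> T2 -> nat)
  (u1 v1 : T1) (u2 v2 : T2) (k : nat) :
  is_graph m1 -> is_graph m2 ->
  (forall D, submodular m1 u1 v1 D) ->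
  (forall D, submodular m2 u2 v2 D) ->
  BN_general m1 v1 ->
  k_general_transmission m2 u2 v2 k ->
  genus m1 + genus m2 < k%:Z ->
  BN_general (glue_mult v1 u2 m1 m2) (glue2 v1 u2 v2).
Proof.
move=> [s1 l1 c1] [s2 l2 c2] _ _ BN1 kg gk D.
have [D1 [D2 [-> _]]] := glueD_split v1 D.
have gs := @glue_sym _ _ v1 u2 _ _ s1 s2; have gl := @glue_loopless _ _ v1 u2 _ _ l1 l2.
have [pa ea] := BN_general_excess s1 l1 c1 D1 BN1.
set chi1 := deg D1 - genus m1 + 1 in pa ea.
have rr := rank_ge_deg_genus s2 l2 c2 (fun n => k_general_rank_ge s2 l2 n kg).
have [kuv _ /(_ D2) [tau [tr [s [sg cov]]]]] := kg.
pose rho := twist_rank m2 u2 v2 D2.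
pose f := rank_function (glue_mult v1 u2 m1 m2) (glue2 v1 u2 v2) (glueD v1 (u2 := u2) D1 D2).
have rhoE (b a : int) : rank m2 (dadd (dadd D2 (dscale (- b) (pt v2))) (dscale a (pt u2))) + 1 = rho b a.
  by rewrite /rho /twist_rank; congr (rank _ _ + 1); divisor_ring.
have mf : is_min_plus (rank_function m1 v1 D1) rho f.
  have up (b a : int) : f b <= rank_function m1 v1 D1 a + rho b (a - 1).
    by rewrite -rhoE /f /rank_function glueD_add_pt2; apply: rank_glue_le.
  move=> b; split; first exact: up.
  have [a le] := rank_glue_attained v1 u2 s1 l1 s2 l2 c1 D1 (dadd D2 (dscale (- b) (pt v2))).
  exists a; apply/eqP; rewrite eq_le up -rhoE /f {2}/rank_function glueD_add_pt2.
  exact: le.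
have gE := genus_glue v1 u2 s1 l1 s2 l2.
have dE := deg_glueD v1 u2 D1 D2.
have pf : rank_profile f (deg D1 + deg D2 - (genus m1 + genus m2) + 1).
  split; first exact: rank_function_steps.
    by exists (deg D1 + deg D2 + 1) => b lb; apply: rank_function_deg; rewrite // dE; lia.
  case: (pa) => _ _ [L aL].
  have [M HM] := rank_le_large s2 l2 c2 v2 (dadd D2 (dscale (L - 1) (pt u2))).
  exists (- M%:Z) => b lb; have [lo [a fa]] := mf b; apply/eqP; rewrite eq_le; apply/andP; split.
    (* Upper bound: at [a = L] the first term is exactly [chi1 - L], and for [b <= - M] the second
       is at most its nonspecial value. *)
    have := lo L; rewrite (aL L) // /rho /twist_rank.
    have := HM (- b); rewrite degD degZ deg_pt /twist /chi1.
    by lia.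
  (* Lower bound: Riemann-Roch inequalities on both sides add up, and [a] cancels. *)
  have := excess_ge0 a pa; have := rr (twist u2 v2 D2 (a - 1) (- b)).
  by rewrite deg_twist fa /rho /twist_rank /excess /chi1; lia.
have k0 : 0 < k%:Z.
  (* The empty list gives [g1 >= 0], and the size of [s] gives [g2 >= 0]. *)
  have : 0 <= genus m1 by have := ea [::] isT; rewrite big_nil.
  by lia.
apply: lambda_sum_le => //; rewrite gE dE //.
move=> w uw; apply: le_trans (_ : genus m1 + (size s)%:Z <= _); last by rewrite lerD2l.
have per (b j : int) := @transmission_periodic _ _ s2 l2 _ _ _ _ _ b j kuv tr.
have tt := transmission_transmits s2 l2 tr.
by apply: (min_plus_excess k0 pa ea (proj1 tr) per cov tt mf pf _ uw); lia.
Qed.
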